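(* Let $\ell>0$, $\xi\in(-\ell,\ell)$, $a_+<0<a_-$, and let $a^0(x):=a_-$ for $x\in(-\ell,\xi)$, $a^0(x):=a_+$ for $x\in(\xi,\ell)$. Let $\{a^\varepsilon\}_{\varepsilon>0}\subset C^0([-\ell,\ell])$ be a family of functions satisfying: (A0) there exists $C>0$, independent of $\varepsilon>0$, such that $|a^\varepsilon|_{\infty}+\varepsilon\left|\frac{da^\varepsilon}{dx}\right|_{\infty}\le C$; (A1) $a^\varepsilon$ is twice differentiable at any $x\ne\xi$, with $\frac{da^\varepsilon}{dx},\frac{d^2a^\varepsilon}{dx^2}<0<a^\varepsilon$ in $(-\ell,\xi)$ and $a^\varepsilon,\frac{da^\varepsilon}{dx}<0<\frac{d^2a^\varepsilon}{dx^2}$ in $(\xi,\ell)$; (A2) for any $C>0$ there exists $c_0>0$ such that, for any $x$ satisfying $|x-\xi|\ge c_0\varepsilon$, there holds $|a^\varepsilon(x)-a^0(x)|\le C\varepsilon$ and $\varepsilon\left|\frac{da^\varepsilon}{dx}(x)\right|\le C$; (A3) the left and right first order derivatives of $a^\varepsilon$ at $\xi$ exist and $\liminf_{\varepsilon\to0^+}\varepsilon\left|\frac{da^\varepsilon}{dx}(\xi\pm)\right|>0$. Then there exists $C>0$ such that, for $\varepsilon$ sufficiently small, the eigenvalues $\lambda^\varepsilon_k$ of the operator $\mathcal L^\varepsilon_\xi u:=\varepsilon u''-(a^\varepsilon(x)u)'$ with boundary conditions $u(\pm\ell)=0$ satisfy $$\lambda^\varepsilon_k\le-C/\varepsilon\quad\text{for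 any }k\ge2,\qquad\text{and}\qquad -C\,e^{-C/\varepsilon}\le\lambda^\varepsilon_1<0.$$
   Context: The spectrum of $\mathcal L^\varepsilon_\xi$ on $(-\ell,\ell)$ with homogeneous Dirichlet conditions consists of real eigenvalues (it is conjugate to a self-adjoint operator), ordered decreasingly $\lambda^\varepsilon_1>\lambda^\varepsilon_2>\dots$. $|\cdot|_\infty$ is the sup norm on $(-\ell,\ell)$. Constants $C$ in the conclusion do not depend on $\varepsilon$. *)

(* Defs.v *)
From Stdlib Require Import Reals.
From Coquelicot Require Import Coquelicot.
Open Scope R_scope.

(* Supremum of |f| over D, as an extended real. *)
Definition sup_norm (D : R -> Prop) (f : R -> R) : Rbar :=
  Lub_Rbar (fun y => exists x, D x /\ y = Rabs (f x)).

(* liminf of f at 0+, i.e. the supremum over d > 0 of the infimum of f on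
   (0, d); that infimum may be -oo, hence the detour through real lower
   bounds y of it (Lub_Rbar takes a set of reals). *)
Definition liminf_0plus (f : R -> R) : Rbar :=
  Lub_Rbar (fun y => exists d, 0 < d /\
    Rbar_le y (Glb_Rbar (fun z => exists e, 0 < e < d /\ z = f e))).

Definition is_derive_left (f : R -> R) (x d : R) : Prop :=
  filterlim (fun h => (f (x + h) - f x) / h) (at_left 0) (locally d).

Definition is_derive_right (f : R -> R) (x d : R) : Prop :=
  filterlim (fun h => (f (x + h) - f x) / h) (at_right 0) (locally d).

(* The limit profile; its value at xi is irrelevant. *)
Definition step (xi am ap x : R) : R := if Rlt_dec x xi then am else ap.

Section Assumptions.

(* a eps is the coefficient a^eps; only its values on [-l, l] matter. *)
Variables (l xi am ap : R) (a : R -> R -> R).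

Definition hyp_A0 : Prop :=
  exists C, 0 < C /\ forall eps, 0 < eps ->
    Rbar_le
      (Rbar_plus
         (sup_norm (fun x => - l < x < l) (a eps))
         (Rbar_mult eps
            (sup_norm (fun x => - l < x < l /\ x <> xi) (Derive (a eps)))))
      C.

Definition hyp_A1 : Prop :=
  forall eps, 0 < eps ->
    (forall x, - l < x < l -> x <> xi ->
       ex_derive (a eps) x /\ ex_derive (Derive (a eps)) x) /\
    (forall x, - l < x < xi ->
       Derive (a eps) x < 0 /\ Derive_n (a eps) 2 x < 0 /\ 0 < a eps x) /\
    (forall x, xi < x < l ->
       a eps x < 0 /\ Derive (a eps) x < 0 /\ 0 < Derive_n (a eps) 2 x).

(* c0 is uniform in eps. *)
Definition hyp_A2 : Prop :=
  forall C, 0 < C -> exists c0, 0 < c0 /\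
    forall eps x, 0 < eps -> - l < x < l -> Rabs (x - xi) >= c0 * eps ->
      Rabs (a eps x - step xi am ap x) <= C * eps /\
      eps * Rabs (Derive (a eps) x) <= C.

Definition hyp_A3 : Prop :=
  exists dl dr : R -> R,
    (forall eps, 0 < eps ->
       is_derive_left (a eps) xi (dl eps) /\
       is_derive_right (a eps) xi (dr eps)) /\
    Rbar_lt 0 (liminf_0plus (fun eps => eps * Rabs (dl eps))) /\
    Rbar_lt 0 (liminf_0plus (fun eps => eps * Rabs (dr eps))).

End Assumptions.

Definition Lop (eps : R) (a u : R -> R) (x : R) : R :=
  eps * Derive_n u 2 x - Derive (fun y => a y * u y) x.

(* The coefficient a need not be differentiable at xi, so neither need u' be:
   eigenfunctions are C^1 across xi and solve the equation pointwise off xi.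
   Since a is Lipschitz and C^1 off xi, these are exactly the eigenfunctions
   of the operator with domain H^2 and zero boundary values. *)
Definition eigenfunction (l xi eps : R) (a : R -> R) (lambda : R) (u : R -> R)
    : Prop :=
  continuous_on (fun x => - l <= x <= l) u /\
  u (- l) = 0 /\ u l = 0 /\
  (exists x, - l < x < l /\ u x <> 0) /\
  (forall x, - l < x < l -> ex_derive u x /\ continuous (Derive u) x) /\
  (forall x, - l < x < l -> x <> xi ->
     ex_derive (Derive u) x /\ Lop eps a u x = lambda * u x).

Definition eigenvalue (l xi eps : R) (a : R -> R) (lambda : R) : Prop :=
  exists u, eigenfunction l xi eps a lambda u.

(* lam 1 > lam 2 > ... lists all the elements of S; lam 0 is a dummy. *)
Definition decreasing_enumeration (S : R -> Prop) (lam : nat -> R) : Prop :=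
  (forall k, (1 <= k)%nat -> lam (k + 1)%nat < lam k) /\
  (forall mu, S mu <-> exists k, (1 <= k)%nat /\ lam k = mu).

(* Main.v *)
Require Import Defs.
From Stdlib Require Import Reals ZArith Lra Lia IndefiniteDescription.
From Coquelicot Require Import Coquelicot.
Open Scope R_scope.

(* With A' = a, A(xi) = 0, W = exp(A / eps) and P = 1 / (eps W), the substitution
   u = W v, phi = eps u' - a u turns the eigenvalue equation into the
   Sturm-Liouville system v' = P phi, phi' = lambda W v with v(-l) = v(l) = 0.
   Its eigenvalues are counted by the Pruefer angle at l, which is continuous,
   strictly decreasing and unbounded in lambda.

   For k >= 2 the eigenfunction vanishes inside (-l, l), so v solves a Dirichlet
   problem on an interval on one side of xi.  There a is bounded away from zero
   outside an O(eps)-layer and pushes towards xi, and a Picone identity with an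
   explicit r that is constant away from the layer and affine inside it gives
   lambda_k <= -C / eps.

   For k = 1, v > 0 and q = phi / v satisfies q' = lambda W - P q^2.  As W is of
   order one on a layer of width eps around xi, |q| is at least of order
   eps |lambda| on one side of xi.  But P is exponentially large near -l and l, so
   the Riccati equation would blow up unless lambda is exponentially small. *)

(** * Differential inequalities and Picard iteration *)

(** The flux form is dictated by the possible kink of the drift at [xi]: there an eigenfunction u is
    only C^1, whereas v and phi solve a first order system whose coefficients are continuous on the
    whole interval. In polar form v vanishes where the Pruefer angle is a multiple of pi, so
    lambda_k is the value for which the angle at l equals k pi; positivity of v for k = 1 and an
    interior zero for k >= 2 are read off from the values the angle takes on the way. In the Picone
    identity a constant r helps only if it lies strictly between 0 and a, so it is positive left of
    xi and negative right of it. In the layer a may be close to 0, and there r has to increase with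
    slope of order 1 / eps to pay for the term r^2. No r can do this on both sides of xi at once, as
    lambda_1 is close to 0; the interior zero is what confines the argument to one side. *)

Lemma is_derive_incr_strict (f f' : R -> R) (x y : R) :
  x < y ->
  (forall z, x <= z <= y -> is_derive f z (f' z)) ->
  (forall z, x < z < y -> 0 < f' z) ->
  f x < f y.
Proof.
intros xy Df f'_gt0.
destruct (MVT_cor2 f f' x y xy) as [c [Hc cxy]].
  intros c Hc; apply is_derive_Reals, Df, Hc.
specialize (f'_gt0 c cxy); nra.
Qed.

Lemma is_derive_incr (f f' : R -> R) (x y : R) :
  x <= y ->
  (forall z, x <= z <= y -> is_derive f z (f' z)) ->
  (forall z, x < z < y -> 0 <= f' z) ->
  f x <= f y.
Proof.
intros [xy | <-] Df f'_ge0; [ | lra].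
destruct (MVT_cor2 f f' x y xy) as [c [Hc cxy]].
  intros c Hc; apply is_derive_Reals, Df, Hc.
specialize (f'_ge0 c cxy); nra.
Qed.

Lemma is_derive_primitive (g : R -> R) (x0 : R) :
  (forall x, continuous g x) ->
  forall x, is_derive (fun x => RInt g x0 x) x (g x).
Proof.
intros cg x; apply is_derive_RInt with x0; [ | apply cg].
apply filter_forall; intros y.
apply (RInt_correct (V := R_CompleteNormedModule)), ex_RInt_continuous.
intros z _; apply cg.
Qed.

Lemma is_derive_ext_value (f : R -> R) (x d d' : R) :
  d = d' -> is_derive f x d -> is_derive f x d'.
Proof. now intros <-. Qed.

Lemma is_derive_continuous (f : R -> R) (x d : R) :
  is_derive f x d -> continuous f x.
Proof. now intros Df; apply (ex_derive_continuous f x); exists d. Qed.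

Lemma exp_nondecreasing (x y : R) : x <= y -> exp x <= exp y.
Proof.
intros [xy | <-]; [now apply Rlt_le, exp_increasing | lra].
Qed.

Lemma lipschitz_continuous (f : R -> R) (B : R) :
  0 < B -> (forall x y, Rabs (f x - f y) <= B * Rabs (x - y)) ->
  forall x, continuous f x.
Proof.
intros B_gt0 lip x P [e He].
assert (eB_gt0 : 0 < e / B) by (apply Rdiv_lt_0_compat; [apply cond_pos | lra]).
exists (mkposreal _ eB_gt0); intros y xy; apply He.
change (Rabs (f y - f x) < e).
change (Rabs (y - x) < e / B) in xy.
apply Rle_lt_trans with (1 := lip y x).
replace (pos e) with (B * (e / B)) by (field; lra).
now apply Rmult_lt_compat_l.
Qed.

Section Picard.

Variables (f : R -> R -> R) (x0 B K : R).
Hypotheses (B_gt0 : 0 < B) (K_gt0 : 0 < K).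
Hypothesis f_bound : forall x y, Rabs (f x y) <= B.
Hypothesis f_lip : forall x y z, Rabs (f x y - f x z) <= K * Rabs (y - z).
Hypothesis f_cont : forall y : R -> R,
  (forall x, continuous y x) -> forall x, continuous (fun x => f x (y x)) x.

Let T (y : R -> R) (x : R) : R := RInt (fun s => f s (y s)) x0 x.

(* A weight for which the Picard operator is a contraction of ratio 1/2 on the
   whole line. *)
Let E (x : R) : R := exp (2 * K * Rabs (x - x0)).

Let T_derive y : (forall x, continuous y x) ->
  forall x, is_derive (T y) x (f x (y x)).
Proof.
intros cy x; apply (is_derive_primitive (fun s => f s (y s))).
now apply f_cont.
Qed.

Let T_x0 y : T y x0 = 0.
Proof. exact (RInt_point x0 (fun s => f s (y s))). Qed.

Let E_ge1 x : 1 <= E x.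
Proof.
unfold E; rewrite <- exp_0; apply exp_nondecreasing.
pose proof (Rabs_pos (x - x0)); nra.
Qed.

(** Away from [x0] the weight satisfies |E'| = 2 K E, so integrating K M E from [x0] gives M / 2 (E
    - 1): this is where the ratio 1/2 comes from. The two sides of [x0] are treated apart because E
    has a corner there. *)
Lemma weighted_integral_bound (g g' : R -> R) (M : R) :
  0 <= M -> g x0 = 0 ->
  (forall x, is_derive g x (g' x)) ->
  (forall x, Rabs (g' x) <= K * M * E x) ->
  forall x, Rabs (g x) <= M / 2 * E x.
Proof.
intros M_ge0 gx0 Dg g'_le x.
assert (key : forall s, s = 1 \/ s = -1 -> s * g x <= M / 2 * E x).
  intros s s1.
  destruct (Rle_lt_dec x0 x) as [x0x | xx0].
    assert (H : M / 2 * exp (2 * K * (x0 - x0)) - s * g x0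
                <= M / 2 * exp (2 * K * (x - x0)) - s * g x).
      apply (is_derive_incr (fun z => M / 2 * exp (2 * K * (z - x0)) - s * g z)
        (fun z => M / 2 * (2 * K * exp (2 * K * (z - x0))) - s * g' z) x0 x x0x).
        intros z _; auto_derive; [now exists (g' z) | ].
        rewrite (is_derive_unique (fun x : R => g x) _ _ (Dg z)); unfold Rminus; ring.
      intros z zx; generalize (g'_le z); unfold E.
      rewrite (Rabs_pos_eq (z - x0)) by lra.
      intros h; apply Rabs_le_between in h.
      destruct s1 as [-> | ->]; lra.
    unfold E; rewrite (Rabs_pos_eq (x - x0)) by lra.
    rewrite gx0 in H; pose proof (exp_pos (2 * K * (x0 - x0))); nra.
  assert (H : s * g x0 - M / 2 * exp (2 * K * (x0 - x0))
              >= s * g x - M / 2 * exp (2 * K * (x0 - x))).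
    apply Rle_ge.
    apply (is_derive_incr (fun z => s * g z - M / 2 * exp (2 * K * (x0 - z)))
      (fun z => s * g' z + M / 2 * (2 * K * exp (2 * K * (x0 - z)))) x x0).
        lra.
      intros z _; auto_derive; [now exists (g' z) | ].
      rewrite (is_derive_unique (fun x : R => g x) _ _ (Dg z)); unfold Rminus; ring.
    intros z zx; generalize (g'_le z); unfold E.
    rewrite (Rabs_minus_sym z), (Rabs_pos_eq (x0 - z)) by lra.
    intros h; apply Rabs_le_between in h.
    destruct s1 as [-> | ->]; lra.
  unfold E; rewrite (Rabs_minus_sym x), (Rabs_pos_eq (x0 - x)) by lra.
  rewrite gx0 in H; pose proof (exp_pos (2 * K * (x0 - x0))); nra.
apply Rabs_le; split; [generalize (key (-1)) | generalize (key 1)]; lra.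
Qed.

Let T_contraction y z M :
  0 <= M -> (forall x, continuous y x) -> (forall x, continuous z x) ->
  (forall x, Rabs (y x - z x) <= M * E x) ->
  forall x, Rabs (T y x - T z x) <= M / 2 * E x.
Proof.
intros M_ge0 cy cz yz.
apply (weighted_integral_bound (fun x => T y x - T z x)
  (fun x => f x (y x) - f x (z x))); auto.
    rewrite !T_x0; ring.
  intros x; apply (is_derive_minus (T y) (T z)); now apply T_derive.
intros x; apply Rle_trans with (1 := f_lip _ _ _).
rewrite Rmult_assoc; apply Rmult_le_compat_l; [lra | apply yz].
Qed.

Let it (n : nat) : R -> R := Nat.iter n T (fun _ => 0).

Let it_cont n x : continuous (it n) x.
Proof.
revert x; induction n as [| n IH]; intros x; [apply continuous_const | ].
eapply is_derive_continuous, T_derive, IH.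
Qed.

Let it_lip n x y : Rabs (it n x - it n y) <= B * Rabs (x - y).
Proof.
destruct n as [| n].
  unfold it; simpl; rewrite Rminus_0_r, Rabs_R0.
  apply Rmult_le_pos; [lra | apply Rabs_pos].
assert (key : forall u v, u <= v -> Rabs (it (S n) u - it (S n) v) <= B * (v - u)).
  intros u v uv.
  assert (D : forall z, is_derive (it (S n)) z (f z (it n z))).
    intros z; apply T_derive, it_cont.
  assert (h1 : B * u - it (S n) u <= B * v - it (S n) v).
    apply (is_derive_incr (fun z => B * z - it (S n) z)
      (fun z => B - f z (it n z))); auto.
      intros z _; apply (is_derive_minus (fun z => B * z)); auto.
      auto_derive; auto; ring.
    intros z _; generalize (f_bound z (it n z)); intros h.
    apply Rabs_le_between in h; lra.
  assert (h2 : B * u + it (S n) u <= B * v + it (S n) v).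
    apply (is_derive_incr (fun z => B * z + it (S n) z)
      (fun z => B + f z (it n z))); auto.
      intros z _; apply (is_derive_plus (fun z => B * z)); auto.
      auto_derive; auto; ring.
    intros z _; generalize (f_bound z (it n z)); intros h.
    apply Rabs_le_between in h; lra.
  apply Rabs_le; lra.
destruct (Rle_lt_dec x y) as [xy | yx].
  rewrite (Rabs_minus_sym x), (Rabs_pos_eq (y - x)) by lra; auto.
rewrite Rabs_minus_sym, (Rabs_pos_eq (x - y)) by lra; apply key; lra.
Qed.

(** Chosen so that B |x - x0| = M (2 K |x - x0|) <= M E(x), which bounds the first iterate in the
    weighted norm. *)
Let M := B / (2 * K).

Let M_ge0 : 0 < M.
Proof. apply Rdiv_lt_0_compat; lra. Qed.

Let it_succ n x : Rabs (it (S n) x - it n x) <= M * (/ 2) ^ n * E x.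
Proof.
revert x; induction n as [| n IH]; intros x.
  apply Rle_trans with (B * Rabs (x - x0)).
    replace (it 1 x - it 0 x) with (it 1 x - it 1 x0); [apply it_lip | ].
    unfold it; simpl; now rewrite T_x0.
  unfold M, E; simpl; rewrite Rmult_1_r.
  replace (B * Rabs (x - x0)) with (B / (2 * K) * (2 * K * Rabs (x - x0)))
    by (field; lra).
  apply Rmult_le_compat_l; [apply Rlt_le, M_ge0 | ].
  apply Rle_trans with (2 := exp_ineq1_le _); lra.
replace (M * (/ 2) ^ S n) with (M * (/ 2) ^ n / 2) by (simpl; field).
apply (T_contraction (it (S n)) (it n)); auto.
apply Rmult_le_pos; [lra | apply pow_le; lra].
Qed.

Let it_tail n k x :
  Rabs (it (n + k)%nat x - it n x) <= 2 * M * (/ 2) ^ n * E x.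
Proof.
(* The exact partial sum of the geometric series is kept, as the induction on k does not close on
   the rounded bound. *)
apply Rle_trans with (2 * M * (/ 2) ^ n * (1 - (/ 2) ^ k) * E x).
  induction k as [| k IH].
    rewrite Nat.add_0_r, Rminus_diag, Rabs_R0; simpl; lra.
  replace (it (n + S k)%nat x - it n x) with
    ((it (S (n + k)) x - it (n + k)%nat x) + (it (n + k)%nat x - it n x))
    by (rewrite Nat.add_succ_r; ring).
  apply Rle_trans with (1 := Rabs_triang _ _).
  apply Rle_trans with (1 := Rplus_le_compat _ _ _ _ (it_succ _ _) IH).
  rewrite pow_add; simpl; right; field.
assert (0 < (/ 2) ^ k) by (apply pow_lt; lra).
assert (0 < (/ 2) ^ n) by (apply pow_lt; lra).
pose proof (E_ge1 x).
assert (0 < 2 * M * (/ 2) ^ n) by nra.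
apply Rmult_le_compat_r; nra.
Qed.

Let geom_small (C e : R) : 0 <= C -> 0 < e ->
  exists N, forall n, (N <= n)%nat -> C * (/ 2) ^ n < e.
Proof.
intros C_ge0 e_gt0.
assert (e' : 0 < e / (C + 1)) by (apply Rdiv_lt_0_compat; lra).
destruct (pow_lt_1_zero (/ 2) (Rabs_def1 (/ 2) 1 ltac:(lra) ltac:(lra)) _ e')
  as [N HN].
exists N; intros n Hn; specialize (HN n Hn).
assert (p : 0 < (/ 2) ^ n) by (apply pow_lt; lra).
rewrite Rabs_pos_eq in HN by lra.
apply Rmult_lt_compat_r with (r := C + 1) in HN; [ | lra].
unfold Rdiv in HN; rewrite Rmult_assoc, Rinv_l in HN by lra; nra.
Qed.

Let it_cvg x : exists y, is_lim_seq (fun n => it n x) (Finite y).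
Proof.
apply ex_lim_seq_cauchy_corr; intros e.
destruct (geom_small (2 * M * E x) (e / 2)) as [N HN].
    pose proof (E_ge1 x); nra.
  apply is_pos_div_2.
assert (tail : forall n, (N <= n)%nat -> Rabs (it n x - it N x) < e / 2).
  intros n Hn; replace n with (N + (n - N))%nat by lia.
  apply Rle_lt_trans with (1 := it_tail _ _ _).
  specialize (HN N (le_n N)); lra.
exists N; intros n m Hn Hm.
replace (it n x - it m x) with ((it n x - it N x) - (it m x - it N x)) by ring.
apply Rle_lt_trans with (1 := Rabs_triang _ _); rewrite Rabs_Ropp.
generalize (tail n Hn) (tail m Hm); lra.
Qed.

Lemma picard :
  exists y : R -> R, y x0 = 0 /\ forall x, is_derive y x (f x (y x)).
Proof.
set (y x := real (Lim_seq (fun n => it n x))).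
assert (y_lim : forall x, is_lim_seq (fun n => it n x) (Finite (y x))).
  intros x; destruct (it_cvg x) as [l Hl]; unfold y.
  now rewrite (is_lim_seq_unique _ _ Hl).
assert (y_tail : forall n x, Rabs (y x - it n x) <= 2 * M * (/ 2) ^ n * E x).
  intros n x.
  apply (is_lim_seq_le (fun k => Rabs (it (k + n)%nat x - it n x))
    (fun _ => 2 * M * (/ 2) ^ n * E x) (Finite (Rabs (y x - it n x)))
    (Finite (2 * M * (/ 2) ^ n * E x))).
      intros k; rewrite Nat.add_comm; apply it_tail.
    apply (is_lim_seq_abs _ (Finite (y x - it n x))).
    apply is_lim_seq_minus'; [ | apply is_lim_seq_const].
    now apply (is_lim_seq_incr_n (fun k => it k x) n).
  apply is_lim_seq_const.
assert (y_cont : forall x, continuous y x).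
  apply lipschitz_continuous with B; auto; intros u v.
  apply (is_lim_seq_le (fun n => Rabs (it n u - it n v))
    (fun _ => B * Rabs (u - v)) (Finite (Rabs (y u - y v)))
    (Finite (B * Rabs (u - v)))).
      intros k; apply it_lip.
    apply (is_lim_seq_abs _ (Finite (y u - y v))).
    now apply is_lim_seq_minus'.
  apply is_lim_seq_const.
assert (yT : forall x, y x = T y x).
  intros x; apply Rminus_diag_uniq.
  destruct (Req_dec (y x - T y x) 0) as [ | neq]; auto; exfalso.
  apply Rabs_pos_lt in neq.
  destruct (geom_small (2 * M * E x) (Rabs (y x - T y x))) as [N HN]; auto.
    pose proof (E_ge1 x); nra.
  specialize (HN N (le_n N)).
  assert (p : 0 < (/ 2) ^ N) by (apply pow_lt; lra).
  assert (h1 := y_tail (S N) x).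
  assert (h2 : Rabs (T y x - it (S N) x) <= 2 * M * (/ 2) ^ N / 2 * E x).
    apply (T_contraction y (it N)); auto.
    assert (0 < M * (/ 2) ^ N) by (apply Rmult_lt_0_compat; auto); lra.
  replace (y x - T y x) with ((y x - it (S N) x) - (T y x - it (S N) x)) in HN
    by ring.
  generalize (Rabs_triang (y x - it (S N) x) (- (T y x - it (S N) x))).
  rewrite Rabs_Ropp.
  replace (2 * M * (/ 2) ^ S N * E x) with (M * E x * (/ 2) ^ N) in h1
    by (simpl; field).
  replace (2 * M * (/ 2) ^ N / 2 * E x) with (M * E x * (/ 2) ^ N) in h2
    by field.
  unfold Rminus in *; lra.
exists y; split; [rewrite yT; apply T_x0 | intros x].
apply is_derive_ext with (T y); [intros t; symmetry; apply yT | ].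
now apply T_derive.
Qed.

End Picard.

(** * Equality case of monotonicity, Gronwall's inequality, trigonometric tools *)

Lemma is_derive_flat (f f' : R -> R) (x y : R) :
  (forall z, x <= z <= y -> is_derive f z (f' z)) ->
  (forall z, x < z < y -> 0 <= f' z) ->
  f x = f y -> forall z, x < z < y -> f' z = 0.
Proof.
intros Df f'_ge0 fxy z zxy.
assert (flat : forall u, x <= u <= y -> f u = f x).
  intros u uxy; apply Rle_antisym.
    rewrite fxy; apply (is_derive_incr f f'); [lra | | ];
      intros; [apply Df | apply f'_ge0]; lra.
  apply (is_derive_incr f f'); [lra | | ];
    intros; [apply Df | apply f'_ge0]; lra.
rewrite <- (is_derive_unique f z (f' z)) by (apply Df; lra).
rewrite <- (Derive_const (f x) z).
apply Derive_ext_loc.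
apply (locally_interval _ z x y); [apply zxy | apply zxy | ].
simpl; intros u xu uy; apply flat; lra.
Qed.

(** The function e z - f(z) exp(- K (z - x)) is nondecreasing. With e = 0 the lemma gives
    uniqueness, with e > 0 dependence on a parameter. *)
Lemma gronwall (f f' : R -> R) (K e x y : R) :
  x <= y -> 0 <= K -> 0 <= e ->
  (forall z, x <= z <= y -> is_derive f z (f' z)) ->
  (forall z, x <= z <= y -> f' z <= K * f z + e) ->
  f x <= 0 -> f y <= e * (y - x) * exp (K * (y - x)).
Proof.
intros xy K_ge0 e_ge0 Df f'_le fx.
assert (h : e * x - f x * exp (- K * (x - x))
            <= e * y - f y * exp (- K * (y - x))).
  apply (is_derive_incr (fun z => e * z - f z * exp (- K * (z - x)))
    (fun z => e - (f' z - K * f z) * exp (- K * (z - x)))); auto.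
    intros z zxy; auto_derive; [now exists (f' z); apply Df | ].
    rewrite (is_derive_unique (fun x : R => f x) _ _ (Df z zxy)).
    unfold Rminus; ring.
  intros z zxy; specialize (f'_le z ltac:(lra)).
  assert (exp (- K * (z - x)) <= 1).
    rewrite <- exp_0; apply exp_nondecreasing; nra.
  pose proof (exp_pos (- K * (z - x))); nra.
rewrite Rminus_diag, Rmult_0_r, exp_0 in h.
assert (h' : f y * exp (- K * (y - x)) <= e * (y - x)) by lra.
apply Rmult_le_compat_r with (r := exp (K * (y - x))) in h';
  [ | apply Rlt_le, exp_pos].
rewrite Rmult_assoc, <- exp_plus in h'.
replace (- K * (y - x) + K * (y - x)) with 0 in h' by ring.
now rewrite exp_0, Rmult_1_r in h'.
Qed.

Lemma Rabs_sin_le (x : R) : Rabs (sin x) <= Rabs x.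
Proof.
assert (pos : forall y, 0 < y -> Rabs (sin y) <= y).
  intros y y_gt0; apply Rabs_le; split; [ | apply Rlt_le, sin_lt_x; lra].
  assert (h : sin 0 + 0 <= sin y + y).
    apply (is_derive_incr (fun z => sin z + z) (fun z => cos z + 1)); [lra | | ].
      intros z _; auto_derive; auto; ring.
    intros z _; generalize (COS_bound z); lra.
  rewrite sin_0 in h; lra.
destruct (Rtotal_order x 0) as [x_lt0 | [-> | x_gt0]].
    rewrite (Rabs_left x) by lra.
    rewrite <- Rabs_Ropp, <- sin_neg; apply pos; lra.
  rewrite sin_0; lra.
rewrite (Rabs_pos_eq x) by lra; now apply pos.
Qed.

(** Continuous at 0 thanks to the value 1. It turns sin of a difference of angles into that
    difference times a continuous factor, so that the equation for the difference becomes linear. *)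
Definition sinc (x : R) : R := if Req_EM_T x 0 then 1 else sin x / x.

Lemma mul_sinc (x : R) : x * sinc x = sin x.
Proof.
unfold sinc; destruct (Req_EM_T x 0) as [-> | x0]; [rewrite sin_0; ring | ].
now field.
Qed.

Lemma continuous_sinc (x : R) : continuous sinc x.
Proof.
destruct (Req_dec x 0) as [-> | x0].
  intros P [e He].
  destruct (derivable_pt_lim_sin_0 e (cond_pos e)) as [d Hd].
  exists d; intros y y0; apply He.
  change (Rabs (y - 0) < d) in y0; rewrite Rminus_0_r in y0.
  change (Rabs (sinc y - sinc 0) < e).
  unfold sinc; destruct (Req_EM_T 0 0) as [_ | []]; auto.
  destruct (Req_EM_T y 0) as [_ | yneq].
    rewrite Rminus_diag, Rabs_R0; apply cond_pos.
  specialize (Hd y yneq y0); now rewrite Rplus_0_l, sin_0, Rminus_0_r in Hd.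
apply continuous_ext_loc with (fun x => sin x / x).
  assert (d_gt0 : 0 < Rabs x) by now apply Rabs_pos_lt.
  exists (mkposreal _ d_gt0); intros y xy.
  change (Rabs (y - x) < Rabs x) in xy.
  unfold sinc; destruct (Req_EM_T y 0) as [-> | ]; auto.
  rewrite Rminus_0_l, Rabs_Ropp in xy; lra.
apply (ex_derive_continuous (fun x => sin x / x)); now auto_derive.
Qed.

Lemma sin_eq_0_pos (x : R) :
  0 < x -> sin x = 0 -> exists k, (1 <= k)%nat /\ x = INR k * PI.
Proof.
intros x_gt0 sx.
destruct (sin_eq_0_0 x sx) as [k xk].
assert (k_gt0 : (0 < k)%Z).
  apply lt_IZR; pose proof PI_RGT_0; nra.
exists (Z.to_nat k); split; [lia | ].
now rewrite INR_IZR_INZ, Z2Nat.id by lia.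
Qed.

Lemma sin_INR_PI (k : nat) : sin (INR k * PI) = 0.
Proof.
apply sin_eq_0_1; exists (Z.of_nat k); now rewrite <- INR_IZR_INZ.
Qed.

(* A strictly increasing lift of [t |-> k t], [t = tan x], fixing the multiples
   of [PI / 2]; it carries the flow [x' = cos^2 x + k^2 sin^2 x] to
   [y' = k]. *)
Definition tan_stretch (k x : R) : R :=
  x + atan ((k - 1) * sin x * cos x / (cos x * cos x + k * (sin x * sin x))).

Lemma is_derive_tan_stretch (k x : R) : 0 < k ->
  is_derive (tan_stretch k) x
    (k / (cos x * cos x + k * k * (sin x * sin x))).
Proof.
intros k_gt0.
pose proof (sin2_cos2 x) as sc1; unfold Rsqr in sc1.
assert (pos : forall j, 0 < j -> 0 < cos x * cos x + j * (sin x * sin x)).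
  intros j j_gt0; nra.
pose proof (pos k k_gt0) as den_gt0.
pose proof (pos (k * k) (Rmult_lt_0_compat _ _ k_gt0 k_gt0)) as den2_gt0.
unfold tan_stretch; auto_derive; [repeat split; lra | ].
generalize dependent (sin x); generalize (cos x); intros C S sc1 _ D_gt0 Q_gt0.
(* X is the derivative of the argument of [atan] and Y is 1 plus the square of that argument. Both
   contain the factor sin^2 + cos^2, which cancels in the quotient. *)
match goal with |- 1 + ?X * / ?Y = _ =>
  replace X with ((S * S + C * C) * ((k - 1) * (C * C - k * (S * S)))
    / ((C * C + k * (S * S)) * (C * C + k * (S * S)))) by (field; lra);
  replace Y with ((S * S + C * C) * (C * C + k * k * (S * S))
    / ((C * C + k * (S * S)) * (C * C + k * (S * S)))) by (field; lra)
end.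
rewrite sc1.
transitivity (k * (S * S + C * C) / (C * C + k * k * (S * S))); [field; lra | ].
rewrite sc1; now rewrite Rmult_1_r.
Qed.

(** * Sturm-Liouville spectrum *)

Ltac ex_derive_context := repeat split; try easy; eexists; eassumption.

(** The system for v and its flux asks for no derivative of p. Derivatives at s and t are two-sided,
    so solutions are meant to extend slightly beyond the interval. *)
Definition sl_solution (p w : R -> R) (s t lam : R) (v phi : R -> R) : Prop :=
  forall x, s <= x <= t ->
    is_derive v x (p x * phi x) /\ is_derive phi x (lam * w x * v x).

Definition sl_eigenvalue (p w : R -> R) (s t lam : R) : Prop :=
  exists v phi, sl_solution p w s t lam v phi /\ v s = 0 /\ v t = 0 /\
    exists x, s < x < t /\ v x <> 0.

Section SturmLiouville.

Variables (p w : R -> R) (m M s t : R).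
Hypotheses (p_cont : forall x, continuous p x) (w_cont : forall x, continuous w x).
Hypotheses (m_gt0 : 0 < m) (st : s < t).
Hypotheses (p_bound : forall x, m <= p x <= M) (w_bound : forall x, m <= w x <= M).

Local Notation solution := (sl_solution p w s t).

Let potential_bound lam x : Rabs (p x + lam * w x) <= M + Rabs lam * M.
Proof.
generalize (p_bound x) (w_bound x); intros.
apply Rle_trans with (1 := Rabs_triang _ _).
rewrite Rabs_mult, !(Rabs_pos_eq (p x)), !(Rabs_pos_eq (w x)) by lra.
apply Rplus_le_compat; [lra | ].
apply Rmult_le_compat_l; [apply Rabs_pos | lra].
Qed.

Let bound_gt0 lam : 0 < M + Rabs lam * M.
Proof. generalize (p_bound 0) (Rabs_pos lam); nra. Qed.

(** * Uniqueness and zeros of solutions *)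

(** The energy v^2 + phi^2 has derivative 2 (p + lam w) v phi, which is at most K times the energy
    in absolute value. Gronwall's inequality applies to the right of [x0] and, after the reflection
    x -> -x, to the left. *)
Lemma sl_solution_unique lam v phi x0 : solution lam v phi ->
  s <= x0 <= t -> v x0 = 0 -> phi x0 = 0 ->
  forall x, s <= x <= t -> v x = 0 /\ phi x = 0.
Proof.
intros sol x0st v0 phi0 x xst.
set (K := M + Rabs lam * M).
assert (D : forall z, s <= z <= t ->
    is_derive (fun z => v z * v z + phi z * phi z) z
      (2 * (p z + lam * w z) * (v z * phi z))).
  intros z zst; destruct (sol z zst) as [Dv Dphi].
  auto_derive; [ex_derive_context | ].
  rewrite (is_derive_unique (fun x : R => v x) _ _ Dv).
  rewrite (is_derive_unique (fun x : R => phi x) _ _ Dphi); ring.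
assert (D_le : forall z e, Rabs e = 1 ->
    e * (2 * (p z + lam * w z) * (v z * phi z))
    <= K * (v z * v z + phi z * phi z) + 0).
  intros z e e1; rewrite Rplus_0_r.
  apply Rle_trans with (1 := Rle_abs _).
  rewrite !Rabs_mult, e1, Rmult_1_l, (Rabs_pos_eq 2) by lra.
  generalize (potential_bound lam z) (Rabs_pos (p z + lam * w z)).
  generalize (Rsqr_abs (v z)) (Rsqr_abs (phi z)); unfold Rsqr; intros -> ->.
  fold K; generalize (Rabs (p z + lam * w z)) (Rabs (v z)) (Rabs (phi z)).
  intros a b c aK a_ge0.
  apply Rle_trans with (a * (b * b + c * c)); [ | nra].
  assert (0 <= (b - c) * (b - c)) by apply Rle_0_sqr; nra.
assert (key : v x * v x + phi x * phi x <= 0).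
  pose proof (Rlt_le _ _ (bound_gt0 lam)) as K_ge0; fold K in K_ge0.
  destruct (Rle_lt_dec x0 x) as [x0x | xx0].
    replace 0 with (0 * (x - x0) * exp (K * (x - x0))) by ring.
    apply (gronwall (fun z => v z * v z + phi z * phi z) _ K 0 x0 x x0x K_ge0
      (Rle_refl 0) (fun z h => D z ltac:(lra))).
      intros z _; rewrite <- (Rmult_1_l (_ * (v z * phi z))).
      apply D_le, Rabs_R1.
    rewrite v0, phi0; lra.
  replace 0 with (0 * (- x - - x0) * exp (K * (- x - - x0))) by ring.
  replace (v x * v x + phi x * phi x)
    with (v (- - x) * v (- - x) + phi (- - x) * phi (- - x))
    by now rewrite Ropp_involutive.
  apply (gronwall (fun z => v (- z) * v (- z) + phi (- z) * phi (- z))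
    (fun z => -1 * (2 * (p (- z) + lam * w (- z)) * (v (- z) * phi (- z))))
    K 0 (- x0) (- x)); try lra.
      intros z h.
      apply (is_derive_comp (fun z => v z * v z + phi z * phi z) Ropp z); [apply D; lra | ].
      auto_derive; auto; ring.
    intros z h; apply D_le; rewrite Rabs_left; lra.
  rewrite Ropp_involutive, v0, phi0; lra.
split; nra.
Qed.

Let nontrivial lam v phi x1 : solution lam v phi ->
  s < x1 < t -> v x1 <> 0 ->
  forall x, s <= x <= t -> v x <> 0 \/ phi x <> 0.
Proof.
intros sol x1st v1 x xst.
destruct (Req_dec (v x) 0) as [v0 | ]; auto.
destruct (Req_dec (phi x) 0) as [phi0 | ]; auto.
now destruct (sl_solution_unique _ _ _ _ sol xst v0 phi0 x1 ltac:(lra)).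
Qed.

(** The product v phi has the nonnegative derivative p phi^2 + lam w v^2 and vanishes at both zeros.
    Hence phi = 0 between them, v is constant there, and uniqueness spreads the zero to the whole
    interval. *)
Lemma sl_no_two_zeros lam v phi x1 x2 : 0 <= lam -> solution lam v phi ->
  s <= x1 < x2 -> x2 <= t -> v x1 = 0 -> v x2 = 0 ->
  forall x, s <= x <= t -> v x = 0.
Proof.
intros lam_ge0 sol sx1 x2t v1 v2 x xst.
set (g z := p z * (phi z * phi z) + lam * (w z * (v z * v z))).
assert (D : forall z, x1 <= z <= x2 -> is_derive (fun z => v z * phi z) z (g z)).
  intros z zst; destruct (sol z ltac:(lra)) as [Dv Dphi].
  auto_derive; [ex_derive_context | ].
  rewrite (is_derive_unique (fun x : R => v x) _ _ Dv).
  rewrite (is_derive_unique (fun x : R => phi x) _ _ Dphi); unfold g; ring.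
assert (g_ge0 : forall z, 0 <= p z * (phi z * phi z) /\
    0 <= lam * (w z * (v z * v z))).
  intros z; generalize (p_bound z) (w_bound z); intros hp hw; split.
    apply Rmult_le_pos; [lra | apply Rle_0_sqr].
  apply Rmult_le_pos, Rmult_le_pos; [lra | lra | apply Rle_0_sqr].
assert (flat : forall z, x1 < z < x2 -> g z = 0).
  apply (is_derive_flat _ _ _ _ D).
    intros z _; generalize (g_ge0 z); unfold g; lra.
  rewrite v1, v2; ring.
assert (phi0 : forall z, x1 < z < x2 -> phi z = 0).
  intros z zx; generalize (flat z zx) (g_ge0 z) (p_bound z); unfold g.
  intros; assert (h : p z * (phi z * phi z) = 0) by lra.
  apply Rmult_integral in h; destruct h as [ | h]; [lra | ].
  now apply Rmult_integral in h; destruct h.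
assert (v_flat : forall y, x1 < y < x2 -> v y = 0).
  intros y yx; rewrite <- v1; apply Rle_antisym.
    apply Ropp_le_cancel, (is_derive_incr (fun z => - v z) (fun z => - (p z * phi z))).
        lra.
      intros z zx; apply (is_derive_opp v); apply sol; lra.
    intros z zx; rewrite phi0; lra.
  apply (is_derive_incr v (fun z => p z * phi z)); [lra | | ].
    intros z zx; apply sol; lra.
  intros z zx; rewrite phi0; lra.
set (y := (x1 + x2) / 2).
assert (yx : x1 < y < x2) by (unfold y; lra).
apply (sl_solution_unique lam v phi y); auto; lra.
Qed.

Lemma sl_eigenvalue_neg lam : sl_eigenvalue p w s t lam -> lam < 0.
Proof.
intros [v [phi [sol [vs [vt [x [xst vx]]]]]]].
apply Rnot_le_lt; intros lam_ge0; apply vx.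
apply (sl_no_two_zeros lam v phi s t); auto; lra.
Qed.

(** * The Pruefer angle, with the convention v = r sin th, phi = r cos th *)

Definition prufer_rhs (lam x th : R) : R :=
  p x * (cos th * cos th) - lam * w x * (sin th * sin th).

Definition prufer_angle (lam : R) (th : R -> R) : Prop :=
  th s = 0 /\ forall x, is_derive th x (prufer_rhs lam x (th x)).

(** Rests on sin^2 a - sin^2 b = sin (a + b) sin (a - b). The factored form yields both the
    Lipschitz bound and the linear equation for the difference of two angles. *)
Lemma prufer_rhs_diff lam x th eta :
  prufer_rhs lam x th - prufer_rhs lam x eta =
  - (p x + lam * w x) * sin (th + eta) * sin (th - eta).
Proof.
unfold prufer_rhs; rewrite sin_plus, sin_minus.
pose proof (sin2_cos2 th) as h1; pose proof (sin2_cos2 eta) as h2.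
unfold Rsqr in h1, h2.
replace (cos th * cos th) with (1 - sin th * sin th) by lra.
replace (cos eta * cos eta) with (1 - sin eta * sin eta) by lra.
transitivity (- (p x + lam * w x) *
  (sin th * sin th * (cos eta * cos eta) - cos th * cos th * (sin eta * sin eta)));
  [ | ring].
replace (cos th * cos th) with (1 - sin th * sin th) by lra.
replace (cos eta * cos eta) with (1 - sin eta * sin eta) by lra.
ring.
Qed.

Lemma prufer_rhs_lipschitz lam x th eta :
  Rabs (prufer_rhs lam x th - prufer_rhs lam x eta)
  <= (M + Rabs lam * M) * Rabs (th - eta).
Proof.
rewrite prufer_rhs_diff, Rmult_assoc, Rabs_mult, Rabs_Ropp.
apply Rmult_le_compat; try apply Rabs_pos; [apply potential_bound | ].
rewrite Rabs_mult, <- (Rmult_1_l (Rabs (th - eta))).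
apply Rmult_le_compat; try apply Rabs_pos; [ | apply Rabs_sin_le].
apply Rabs_le, SIN_bound.
Qed.

Let sqr_sin_bound x : 0 <= sin x * sin x <= 1.
Proof.
split; [apply Rle_0_sqr | generalize (SIN_bound x); nra].
Qed.

Let sqr_cos_bound x : 0 <= cos x * cos x <= 1.
Proof.
split; [apply Rle_0_sqr | generalize (COS_bound x); nra].
Qed.

Lemma prufer_angle_exists lam : exists th, prufer_angle lam th.
Proof.
apply picard with (M + Rabs lam * M) (M + Rabs lam * M); auto.
    intros x th; unfold prufer_rhs, Rminus.
    apply Rle_trans with (1 := Rabs_triang _ _).
    rewrite Rabs_Ropp, !Rabs_mult.
    generalize (p_bound x) (w_bound x); intros.
    rewrite (Rabs_pos_eq (p x)), (Rabs_pos_eq (w x)) by lra.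
    rewrite <- !Rabs_mult.
    rewrite (Rabs_pos_eq (cos th * cos th)), (Rabs_pos_eq (sin th * sin th))
      by (apply sqr_sin_bound || apply sqr_cos_bound).
    generalize (sqr_sin_bound th) (sqr_cos_bound th) (Rabs_pos lam); intros.
    apply Rplus_le_compat; [nra | ].
    rewrite Rmult_assoc; apply Rmult_le_compat_l; nra.
  apply prufer_rhs_lipschitz.
intros y cy x; unfold prufer_rhs.
assert (cc : continuous (fun x => cos (y x)) x).
  apply (continuous_comp y cos); auto; apply continuous_cos.
assert (cs : continuous (fun x => sin (y x)) x).
  apply (continuous_comp y sin); auto; apply continuous_sin.
apply (continuous_minus (fun x => p x * (cos (y x) * cos (y x)))).
  now apply (continuous_mult p); [ | apply (continuous_mult (K := R_AbsRing))].
apply (continuous_mult (fun x => lam * w x)).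
  now apply (continuous_scal_r (V := R_NormedModule) lam w).
now apply (continuous_mult (K := R_AbsRing)).
Qed.

(* The difference D of the angles satisfies
   D' = g D + (lam2 - lam1) w sin^2 th2 with g continuous. *)
Lemma prufer_angle_decr lam1 lam2 th1 th2 :
  lam1 < lam2 -> prufer_angle lam1 th1 -> prufer_angle lam2 th2 ->
  th2 t < th1 t.
Proof.
intros lam12 [th1s Dth1] [th2s Dth2].
assert (cth1 : forall x, continuous th1 x).
  intros x; eapply is_derive_continuous, Dth1.
assert (cth2 : forall x, continuous th2 x).
  intros x; eapply is_derive_continuous, Dth2.
set (g x := - (p x + lam1 * w x) * sin (th1 x + th2 x) * sinc (th1 x - th2 x)).
assert (cg : forall x, continuous g x).
  intros x; apply (continuous_mult (K := R_AbsRing)).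
    apply (continuous_mult (K := R_AbsRing)).
      apply (continuous_opp (V := R_NormedModule)).
      apply (continuous_plus (V := R_NormedModule)); auto.
      now apply (continuous_scal_r (V := R_NormedModule) lam1 w).
    apply (continuous_comp (fun x => th1 x + th2 x) sin).
      now apply (continuous_plus (V := R_NormedModule)).
    apply continuous_sin.
  apply (continuous_comp (fun x => th1 x - th2 x) sinc).
    now apply (continuous_minus (V := R_NormedModule)).
  apply continuous_sinc.
set (G x := RInt g s x).
assert (DG : forall x, is_derive G x (g x)) by now apply is_derive_primitive.
set (h x := (lam2 - lam1) * w x * (sin (th2 x) * sin (th2 x)) * exp (- G x)).
assert (D : forall x, s <= x <= t ->
    is_derive (fun x => (th1 x - th2 x) * exp (- G x)) x (h x)).
  intros x _; apply is_derive_ext_value with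
    ((prufer_rhs lam1 x (th1 x) - prufer_rhs lam2 x (th2 x)) * exp (- G x)
     + (th1 x - th2 x) * (- g x * exp (- G x))).
    replace (prufer_rhs lam1 x (th1 x) - prufer_rhs lam2 x (th2 x)) with
      ((prufer_rhs lam1 x (th1 x) - prufer_rhs lam1 x (th2 x))
        + (lam2 - lam1) * w x * (sin (th2 x) * sin (th2 x)))
      by (unfold prufer_rhs; ring).
    rewrite prufer_rhs_diff, <- (mul_sinc (th1 x - th2 x)); unfold h, g; ring.
  apply (is_derive_mult (fun x => th1 x - th2 x) (fun x => exp (- G x))).
      now apply (is_derive_minus th1 th2).
    auto_derive; [now exists (g x) | ].
    rewrite (is_derive_unique (fun x : R => G x) _ _ (DG x)); ring.
  intros; apply Rmult_comm.
assert (h_ge0 : forall x, 0 <= h x).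
  intros x; generalize (w_bound x) (exp_pos (- G x)); intros.
  apply Rmult_le_pos, Rlt_le; auto.
  apply Rmult_le_pos, Rle_0_sqr; apply Rmult_le_pos; lra.
(* Otherwise the weighted difference starts at 0, is nondecreasing and ends at a value <= 0, so its
   derivative vanishes. This forces sin [th2] = 0 throughout (s, t), although its derivative there
   would be p cos [th2], which is nonzero. *)
apply Rnot_le_lt; intros th12.
assert (mono := is_derive_incr _ _ s t (Rlt_le _ _ st) D (fun x _ => h_ge0 x)).
assert (flat : forall x, s < x < t -> h x = 0).
  apply (is_derive_flat _ _ _ _ D); auto.
  apply Rle_antisym; auto.
  rewrite th1s, th2s, Rminus_diag, Rmult_0_l.
  generalize (exp_pos (- G t)); nra.
assert (s0 : forall x, s < x < t -> sin (th2 x) = 0).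
  intros x xst; generalize (flat x xst); unfold h; intros h0.
  generalize (w_bound x) (exp_pos (- G x)); intros.
  apply Rmult_integral in h0; destruct h0 as [h0 | ]; [ | lra].
  apply Rmult_integral in h0; destruct h0 as [h0 | h0].
    apply Rmult_integral in h0; lra.
  now apply Rmult_integral in h0; destruct h0.
set (x := (s + t) / 2).
assert (xst : s < x < t) by (unfold x; lra).
assert (Ds : is_derive (fun x => sin (th2 x)) x (p x * cos (th2 x))).
  auto_derive; [now exists (prufer_rhs lam2 x (th2 x)) | ].
  rewrite (is_derive_unique (fun x : R => th2 x) _ _ (Dth2 x)).
  unfold prufer_rhs.
  generalize (sin2_cos2 (th2 x)); unfold Rsqr; rewrite s0 by lra.
  intros c1; replace (cos (th2 x) * cos (th2 x)) with 1 by lra; ring.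
assert (c0 : p x * cos (th2 x) = 0).
  rewrite <- (is_derive_unique _ _ _ Ds), <- (Derive_const 0 x).
  apply Derive_ext_loc, (locally_interval _ x s t); [apply xst | apply xst | ].
  simpl; intros; now apply s0.
generalize (sin2_cos2 (th2 x)) (p_bound x); unfold Rsqr; rewrite s0 by lra.
apply Rmult_integral in c0; destruct c0 as [-> | ->]; lra.
Qed.

(** The constant depends on [lam1] alone, because the change of parameter is isolated as a forcing
    term of size at most M |lam2 - lam1| and only the field for [lam1] is compared at two angles.
    Beyond continuity in the parameter, the case [lam2] = [lam1] gives uniqueness of the angle at
    t. *)
Lemma prufer_angle_lipschitz lam1 : exists C, 0 < C /\
  forall lam2 th1 th2, prufer_angle lam1 th1 -> prufer_angle lam2 th2 ->
    Rabs (th2 t - th1 t) <= C * Rabs (lam2 - lam1).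
Proof.
(* Twice the Lipschitz constant, as the squared difference is estimated; the extra 1 comes from
   Young's inequality applied to the forcing term. *)
set (K := 2 * (M + Rabs lam1 * M) + 1).
set (Q := M * M * (t - s) * exp (K * (t - s))).
pose proof (bound_gt0 lam1).
assert (M_gt0 : 0 < M) by (generalize (p_bound 0); lra).
assert (Q_gt0 : 0 < Q).
  unfold Q; repeat apply Rmult_lt_0_compat; try lra; apply exp_pos.
exists (sqrt Q); split; [now apply sqrt_lt_R0 | ].
intros lam2 th1 th2 [th1s Dth1] [th2s Dth2].
rewrite <- !sqrt_Rsqr_abs, <- sqrt_mult; [ | lra | apply Rle_0_sqr].
apply sqrt_le_1_alt.
replace (Q * Rsqr (lam2 - lam1)) with
  (Rsqr (M * (lam2 - lam1)) * (t - s) * exp (K * (t - s)))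
  by (unfold Q, Rsqr; ring).
apply (gronwall (fun x => Rsqr (th2 x - th1 x)) (fun x => 2 * (th2 x - th1 x)
  * (prufer_rhs lam2 x (th2 x) - prufer_rhs lam1 x (th1 x)))); try lra.
      unfold K; lra.
    apply Rle_0_sqr.
  intros x _; apply is_derive_ext_value with
    ((prufer_rhs lam2 x (th2 x) - prufer_rhs lam1 x (th1 x)) * (th2 x - th1 x)
    + (th2 x - th1 x) * (prufer_rhs lam2 x (th2 x) - prufer_rhs lam1 x (th1 x))).
    ring.
  apply (is_derive_mult (fun x => th2 x - th1 x) (fun x => th2 x - th1 x));
    [ | | intros; apply Rmult_comm]; now apply (is_derive_minus th2 th1).
intros x _; set (D := th2 x - th1 x).
replace (prufer_rhs lam2 x (th2 x) - prufer_rhs lam1 x (th1 x)) with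
  ((prufer_rhs lam1 x (th2 x) - prufer_rhs lam1 x (th1 x))
    - (lam2 - lam1) * (w x * (sin (th2 x) * sin (th2 x))))
  by (unfold prufer_rhs; ring).
generalize (prufer_rhs_lipschitz lam1 x (th2 x) (th1 x)); fold D.
generalize (prufer_rhs lam1 x (th2 x) - prufer_rhs lam1 x (th1 x)); intros F F_le.
assert (q_bound : 0 <= w x * (sin (th2 x) * sin (th2 x)) <= M).
  generalize (w_bound x) (sqr_sin_bound (th2 x)); intros; split; [ | nra].
  apply Rmult_le_pos; lra.
generalize dependent (w x * (sin (th2 x) * sin (th2 x))); intros q q_bound.
assert (DF : D * F <= (M + Rabs lam1 * M) * (D * D)).
  apply Rle_trans with (1 := Rle_abs _); rewrite Rabs_mult.
  replace (D * D) with (Rabs D * Rabs D)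
    by (rewrite <- Rabs_mult; apply Rabs_pos_eq, Rle_0_sqr).
  generalize (Rabs_pos D); nra.
assert (AG : - (2 * D * ((lam2 - lam1) * q))
    <= D * D + (lam2 - lam1) * (lam2 - lam1) * (M * M)).
  assert (0 <= Rsqr (D + (lam2 - lam1) * q)) by apply Rle_0_sqr.
  assert (q * q <= M * M) by nra.
  assert (0 <= Rsqr (lam2 - lam1)) by apply Rle_0_sqr.
  unfold Rsqr in *; nra.
unfold K, Rsqr; lra.
rewrite th1s, th2s, Rminus_diag, Rsqr_0; lra.
Qed.

(** For lam = - k^2 the stretched angle grows at rate at least k m, since p and w are at least m.
    Stretching moves an angle by less than pi / 2, so the true angle at t exceeds k m (t - s) - pi /
    2, and [k] is chosen to make this at least y. *)
Lemma prufer_angle_unbounded y : exists lam, lam < 0 /\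
  forall th, prufer_angle lam th -> y <= th t.
Proof.
set (k := (Rabs y + PI / 2) / (m * (t - s)) + 1).
assert (mts : 0 < m * (t - s)) by (apply Rmult_lt_0_compat; lra).
pose proof PI_RGT_0; pose proof (Rabs_pos y).
assert (k_gt0 : 0 < k).
  assert (0 < (Rabs y + PI / 2) / (m * (t - s))); [ | unfold k; lra].
  apply Rdiv_lt_0_compat; lra.
assert (k_big : y + PI / 2 <= k * m * (t - s)).
  unfold k; generalize (Rle_abs y); intros.
  replace (((Rabs y + PI / 2) / (m * (t - s)) + 1) * m * (t - s))
    with (Rabs y + PI / 2 + m * (t - s)) by (field; lra); lra.
exists (- (k * k)); split; [nra | intros th [ths Dth]].
set (h x := k / (cos (th x) * cos (th x) + k * k * (sin (th x) * sin (th x)))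
  * prufer_rhs (- (k * k)) x (th x)).
assert (mono : tan_stretch k (th s) - k * m * s <= tan_stretch k (th t) - k * m * t).
  apply (is_derive_incr (fun x => tan_stretch k (th x) - k * m * x)
    (fun x => h x - k * m)); [lra | | ].
    intros x _; apply (is_derive_minus (fun x => tan_stretch k (th x))).
      apply is_derive_ext_value with (prufer_rhs (- (k * k)) x (th x) *
        (k / (cos (th x) * cos (th x) + k * k * (sin (th x) * sin (th x))))).
        unfold h; ring.
      apply (is_derive_comp (tan_stretch k) th); auto.
      now apply is_derive_tan_stretch.
    auto_derive; auto; ring.
  intros x _; unfold h, prufer_rhs.
  generalize (sin2_cos2 (th x)) (p_bound x) (w_bound x); unfold Rsqr.
  generalize (Rle_0_sqr (cos (th x))) (Rle_0_sqr (sin (th x))); unfold Rsqr.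
  generalize (sin (th x) * sin (th x)) (cos (th x) * cos (th x)).
  intros S C C_ge0 S_ge0 SC1 px wx.
  assert (k2 : 0 < k * k) by nra.
  assert (den : 0 < C + k * k * S) by (destruct S_ge0 as [ | <-]; nra).
  replace (k / (C + k * k * S) * (p x * C - - (k * k) * w x * S) - k * m) with
    (k * ((p x - m) * C + k * k * ((w x - m) * S)) / (C + k * k * S))
    by (field; lra).
  apply Rdiv_le_0_compat; auto; apply Rmult_le_pos; [lra | ].
  apply Rplus_le_le_0_compat; [apply Rmult_le_pos; lra | ].
  apply Rmult_le_pos, Rmult_le_pos; lra.
rewrite ths in mono; unfold tan_stretch in mono at 1.
rewrite sin_0, Rmult_0_r, Rmult_0_l, Rdiv_0_l, atan_0 in mono.
unfold tan_stretch in mono.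
generalize (atan_bound ((k - 1) * sin (th t) * cos (th t) /
  (cos (th t) * cos (th t) + k * (sin (th t) * sin (th t))))); lra.
Qed.

(** Once the angle is known, the amplitude obeys the linear equation r' = (p + lam w) sin th cos th
    r, solved by the exponential of a primitive. *)
Lemma prufer_solution lam th : prufer_angle lam th ->
  exists v phi, solution lam v phi /\
    forall x, exists r, 0 < r /\ v x = r * sin (th x) /\ phi x = r * cos (th x).
Proof.
intros [ths Dth].
assert (cth : forall x, continuous th x).
  intros x; eapply is_derive_continuous, Dth.
set (g x := (p x + lam * w x) * (sin (th x) * cos (th x))).
assert (cg : forall x, continuous g x).
  intros x; apply (continuous_mult (K := R_AbsRing)).
    apply (continuous_plus (V := R_NormedModule)); auto.
    now apply (continuous_scal_r (V := R_NormedModule) lam w).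
  apply (continuous_mult (K := R_AbsRing)).
    apply (continuous_comp th sin); auto; apply continuous_sin.
  apply (continuous_comp th cos); auto; apply continuous_cos.
set (G x := RInt g s x).
assert (DG : forall x, is_derive G x (g x)) by now apply is_derive_primitive.
exists (fun x => exp (G x) * sin (th x)), (fun x => exp (G x) * cos (th x)).
split; [ | intros x; exists (exp (G x)); split; auto; apply exp_pos].
intros x _; generalize (DG x) (Dth x); intros DGx Dthx.
generalize (sin2_cos2 (th x)); unfold Rsqr; intros sc1.
split; (auto_derive; [ex_derive_context | ]);
  rewrite (is_derive_unique (fun x : R => G x) _ _ DGx);
  rewrite (is_derive_unique (fun x : R => th x) _ _ Dthx); unfold g, prufer_rhs.
  transitivity (p x * (exp (G x) * cos (th x)) *
    (sin (th x) * sin (th x) + cos (th x) * cos (th x))); [ring | ].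
  rewrite sc1; ring.
transitivity (lam * w x * (exp (G x) * sin (th x)) *
  (sin (th x) * sin (th x) + cos (th x) * cos (th x))); [ring | ].
rewrite sc1; ring.
Qed.

(** [D] measures how far (v, phi) is from being parallel to (sin th, cos th). It solves D' = - q D
    and vanishes at s, hence also at t, where v = 0 and phi <> 0. This avoids lifting the direction
    of the given solution to a continuous angle. *)
Lemma prufer_angle_eigenvalue lam th : prufer_angle lam th ->
  sl_eigenvalue p w s t lam -> sin (th t) = 0.
Proof.
intros [ths Dth] [v [phi [sol [vs [vt [x [xst vx]]]]]]].
set (D x := v x * cos (th x) - phi x * sin (th x)).
set (q x := (p x + lam * w x) * sin (th x) * cos (th x)).
assert (D2 : Rsqr (D t) <= 0).
  replace 0 with (0 * (t - s) * exp (2 * (M + Rabs lam * M) * (t - s))) by ring.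
  apply (gronwall (fun x => Rsqr (D x)) (fun x => - 2 * q x * Rsqr (D x)));
    try lra.
        generalize (bound_gt0 lam); lra.
      intros z zst; destruct (sol z zst) as [Dv Dphi]; pose proof (Dth z) as Dthz.
      unfold Rsqr, D; auto_derive; [ex_derive_context | ].
      rewrite (is_derive_unique (fun x : R => v x) _ _ Dv).
      rewrite (is_derive_unique (fun x : R => phi x) _ _ Dphi).
      rewrite (is_derive_unique (fun x : R => th x) _ _ Dthz).
      unfold q, prufer_rhs; pose proof (sin2_cos2 (th z)) as sc1; unfold Rsqr in sc1.
      set (S := sin (th z)) in *; set (C := cos (th z)) in *.
      assert (hp : p z = p z * (S * S + C * C)) by (rewrite sc1; ring).
      assert (hw : w z = w z * (S * S + C * C)) by (rewrite sc1; ring).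
      transitivity (2 * (v z * C - phi z * S) *
        ((p z * (S * S + C * C)) * phi z * C
         - v z * S * (p z * (C * C) - lam * w z * (S * S))
         - lam * (w z * (S * S + C * C)) * v z * S
         - phi z * C * (p z * (C * C) - lam * w z * (S * S)))).
        rewrite <- hp, <- hw; ring.
      ring.
    intros z _; rewrite Rplus_0_r; apply Rmult_le_compat_r; [apply Rle_0_sqr | ].
    apply Rle_trans with (1 := Rle_abs _); unfold q.
    rewrite !Rabs_mult, (Rabs_left (-2)) by lra.
    generalize (potential_bound lam z) (Rabs_pos (p z + lam * w z)).
    assert (Rabs (sin (th z)) <= 1) by apply Rabs_le, SIN_bound.
    assert (Rabs (cos (th z)) <= 1) by apply Rabs_le, COS_bound.
    pose proof (Rabs_pos (sin (th z))); pose proof (Rabs_pos (cos (th z))).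
    assert (Rabs (sin (th z)) * Rabs (cos (th z)) <= 1) by nra.
    intros; nra.
  unfold D; rewrite ths, vs, sin_0, Rmult_0_l, Rmult_0_r, Rminus_diag, Rsqr_0; lra.
assert (D0 : D t = 0) by (apply Rsqr_eq_0, Rle_antisym; [easy | apply Rle_0_sqr]).
unfold D in D0; rewrite vt in D0.
assert (phit : phi t * sin (th t) = 0) by lra.
apply Rmult_integral in phit; destruct phit as [phit | ]; auto.
destruct (nontrivial lam v phi x sol xst vx t) as [nv | nphi]; [lra | | ];
  contradiction.
Qed.

Lemma prufer_angle_incr lam th x y : lam < 0 -> prufer_angle lam th ->
  x < y -> th x < th y.
Proof.
intros lam_lt0 [ths Dth] xy.
apply (is_derive_incr_strict th (fun x => prufer_rhs lam x (th x))); auto.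
intros z _; unfold prufer_rhs.
generalize (sin2_cos2 (th z)) (p_bound z) (w_bound z); unfold Rsqr; intros.
assert (0 < - lam * w z) by (apply Rmult_lt_0_compat; lra).
generalize (sqr_sin_bound (th z)) (sqr_cos_bound (th z)); intros.
destruct (Req_dec (sin (th z) * sin (th z)) 0); nra.
Qed.

Let prufer_continuity lam th : prufer_angle lam th -> continuity th.
Proof.
intros [_ Dth] x; apply continuity_pt_filterlim.
eapply is_derive_continuous, Dth.
Qed.

(** An angle reaching pi would produce a nonzero solution for lam = 0 with two zeros. Thus lam = 0
    lies below every target k pi, k >= 1, and can serve as one end in the intermediate value
    argument. *)
Lemma prufer_angle_0 th : prufer_angle 0 th -> th t < PI.
Proof.
intros pth; pose proof PI_RGT_0; apply Rnot_le_lt; intros tht.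
destruct (IVT_gen th s t PI) as [z [zst thz]].
    apply (prufer_continuity _ _ pth).
  rewrite (proj1 pth), Rmin_left, Rmax_right by lra; lra.
rewrite Rmin_left, Rmax_right in zst by lra.
assert (sz : s < z).
  destruct (proj1 zst) as [ | <-]; auto.
  rewrite (proj1 pth) in thz; lra.
assert (half : exists y, s <= y <= z /\ th y = PI / 2).
  destruct (IVT_gen th s z (PI / 2)) as [y [ysz thy]].
      apply (prufer_continuity _ _ pth).
    rewrite (proj1 pth), thz, Rmin_left, Rmax_right by lra; lra.
  rewrite Rmin_left, Rmax_right in ysz by lra; now exists y.
destruct half as [y [ysz thy]].
destruct (prufer_solution 0 th pth) as [v [phi [sol polar]]].
assert (vy : v y = 0).
  apply (sl_no_two_zeros 0 v phi s z); auto; try lra.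
    destruct (polar s) as [r [_ [-> _]]]; rewrite (proj1 pth), sin_0; ring.
  destruct (polar z) as [r [_ [-> _]]]; rewrite thz, sin_PI; ring.
destruct (polar y) as [r [r_gt0 [vy' _]]].
rewrite thy, sin_PI2 in vy'; lra.
Qed.

Lemma prufer_angle_attains k : (1 <= k)%nat ->
  exists lam, lam < 0 /\ exists th, prufer_angle lam th /\ th t = INR k * PI.
Proof.
intros k1.
destruct (functional_choice _ prufer_angle_exists) as [th pth].
destruct (prufer_angle_unbounded (INR k * PI)) as [lam0 [lam0_lt0 big]].
pose proof PI_RGT_0.
assert (INR 1 <= INR k) by now apply le_INR.
assert (small : th 0 t < INR k * PI).
  generalize (prufer_angle_0 _ (pth 0)); simpl in *; nra.
specialize (big _ (pth lam0)).
destruct (IVT_gen (fun lam => th lam t) lam0 0 (INR k * PI)) as [lam [lam_b Hlam]].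
    intros lam; apply continuity_pt_filterlim.
    destruct (prufer_angle_lipschitz lam) as [C [C_gt0 lip]].
    intros P [e He].
    assert (eC : 0 < e / C) by (apply Rdiv_lt_0_compat; [apply cond_pos | lra]).
    exists (mkposreal _ eC); intros mu mulam; apply He.
    change (Rabs (mu - lam) < e / C) in mulam.
    change (Rabs (th mu t - th lam t) < e).
    apply Rle_lt_trans with (1 := lip _ _ _ (pth lam) (pth mu)).
    replace (pos e) with (C * (e / C)) by (field; lra).
    now apply Rmult_lt_compat_l.
  rewrite Rmin_right, Rmax_left by lra; lra.
rewrite Rmin_left, Rmax_right in lam_b by lra.
exists lam; split; [ | now exists (th lam)].
destruct (proj2 lam_b) as [ | ->]; lra.
Qed.

(** [lam k] is the parameter for which the angle ends at k pi. Conversely, an eigenvalue is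
    negative, so its angle increases from 0 and ends at a positive multiple of pi; strict
    monotonicity in the parameter identifies it with some [lam k]. *)
Theorem sturm_liouville_spectrum : exists lam : nat -> R,
  decreasing_enumeration (sl_eigenvalue p w s t) lam /\
  forall k, (1 <= k)%nat -> lam k < 0 /\
    exists v phi, solution (lam k) v phi /\ v s = 0 /\ v t = 0 /\
      (forall x, s <= x <= t -> v x <> 0 \/ phi x <> 0) /\
      (exists x, s < x < t /\ v x <> 0) /\
      (k = 1%nat -> forall x, s < x < t -> 0 < v x) /\
      ((2 <= k)%nat -> exists z, s < z < t /\ v z = 0).
Proof.
destruct (functional_choice (fun k lam => (1 <= k)%nat -> lam < 0 /\
  exists th, prufer_angle lam th /\ th t = INR k * PI)) as [lam Hlam].
  intros [ | k]; [exists 0; lia | ].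
  destruct (prufer_angle_attains (S k)) as [lam Hlam]; [lia | now exists lam].
pose proof PI_RGT_0 as PI_gt0.
assert (eigen : forall k, (1 <= k)%nat -> lam k < 0 /\
    exists v phi, solution (lam k) v phi /\ v s = 0 /\ v t = 0 /\
      (forall x, s <= x <= t -> v x <> 0 \/ phi x <> 0) /\
      (exists x, s < x < t /\ v x <> 0) /\
      (k = 1%nat -> forall x, s < x < t -> 0 < v x) /\
      ((2 <= k)%nat -> exists z, s < z < t /\ v z = 0)).
  intros k k1; destruct (Hlam k k1) as [lam_lt0 [th [pth tht]]].
  split; auto.
  destruct (prufer_solution _ _ pth) as [v [phi [sol polar]]].
  assert (incr := fun x y => prufer_angle_incr _ _ x y lam_lt0 pth).
  assert (ths := proj1 pth).
  exists v, phi; split; auto; split; [ | split; [ | split; [ | split; [ | split]]]].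
          destruct (polar s) as [r [_ [-> _]]]; rewrite ths, sin_0; ring.
        destruct (polar t) as [r [_ [-> _]]]; rewrite tht, sin_INR_PI; ring.
      intros x _; destruct (polar x) as [r [r_gt0 [-> ->]]].
      generalize (sin2_cos2 (th x)); unfold Rsqr; intros sc1.
      destruct (Req_dec (sin (th x)) 0) as [s0 | s0].
        right; apply Rmult_integral_contrapositive; split; [lra | intros c0].
        rewrite s0, c0 in sc1; lra.
      left; apply Rmult_integral_contrapositive; split; lra.
      destruct (IVT_gen th s t (PI / 2)) as [y [yst thy]].
          apply (prufer_continuity _ _ pth).
        apply le_INR in k1; simpl in k1.
        rewrite ths, tht, Rmin_left, Rmax_right by nra; nra.
      rewrite Rmin_left, Rmax_right in yst by lra.
      exists y; split; [split | ].
          destruct (proj1 yst) as [ | <-]; auto; lra.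
        apply le_INR in k1; simpl in k1.
        destruct (proj2 yst) as [ | ->]; auto; nra.
      destruct (polar y) as [r [r_gt0 [-> _]]]; rewrite thy, sin_PI2; lra.
    intros -> x xst; destruct (polar x) as [r [r_gt0 [-> _]]].
    generalize (incr s x ltac:(lra)) (incr x t ltac:(lra)).
    rewrite ths, tht; simpl; intros; apply Rmult_lt_0_compat; auto.
    apply sin_gt_0; lra.
  intros k2; apply le_INR in k2; simpl in k2.
  (* As the angle ends at k pi >= 2 pi, it passes pi strictly before t, which gives the interior
     zero. *)
  destruct (IVT_gen th s t PI) as [z [zst thz]].
      apply (prufer_continuity _ _ pth).
    rewrite ths, tht, Rmin_left, Rmax_right by nra; nra.
  rewrite Rmin_left, Rmax_right in zst by lra.
  exists z; split; [split | ].
      destruct (proj1 zst) as [ | <-]; auto; lra.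
    destruct (proj2 zst) as [ | ->]; auto; nra.
  destruct (polar z) as [r [_ [-> _]]]; rewrite thz, sin_PI; ring.
exists lam; split; auto; split.
  intros k k1; destruct (Hlam k k1) as [_ [th1 [pth1 th1t]]].
  destruct (Hlam (k + 1)%nat ltac:(lia)) as [_ [th2 [pth2 th2t]]].
  rewrite plus_INR in th2t; simpl in th2t.
  destruct (Rtotal_order (lam (k + 1)%nat) (lam k)) as [ | [e | lt]]; auto; exfalso.
    rewrite e in pth2.
    destruct (prufer_angle_lipschitz (lam k)) as [C [_ lip]].
    generalize (lip _ _ _ pth1 pth2); rewrite Rminus_diag, Rabs_R0, Rmult_0_r.
    generalize (Rle_abs (th2 t - th1 t)); nra.
  generalize (prufer_angle_decr _ _ _ _ lt pth1 pth2); nra.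
intros mu; split.
  intros eig; pose proof (sl_eigenvalue_neg _ eig) as mu_lt0.
  destruct (prufer_angle_exists mu) as [th pth].
  destruct (sin_eq_0_pos (th t)) as [k [k1 tht]].
      rewrite <- (proj1 pth); apply (prufer_angle_incr mu); auto.
    now apply prufer_angle_eigenvalue with mu.
  exists k; split; auto.
  destruct (Hlam k k1) as [_ [th' [pth' th't]]].
  destruct (Rtotal_order (lam k) mu) as [lt | [ | lt]]; auto; exfalso.
    generalize (prufer_angle_decr _ _ _ _ lt pth' pth); lra.
  generalize (prufer_angle_decr _ _ _ _ lt pth pth'); lra.
intros [k [k1 <-]].
destruct (eigen k k1) as [_ [v [phi [sol [vs [vt [_ [nz _]]]]]]]].
now exists v, phi.
Qed.

End SturmLiouville.

(** * Convection-diffusion operators *)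

(** Only continuity is required at the end points, so that [xi] can be one of them even though the
    eigenvalue equation says nothing at that point. *)
Lemma derive_zero_const (f : R -> R) (x y : R) :
  (forall z, Rmin x y < z < Rmax x y -> is_derive f z 0) ->
  (forall z, Rmin x y <= z <= Rmax x y -> continuous f z) ->
  f y = f x.
Proof.
intros Df cf.
destruct (MVT_gen f x y (fun _ => 0) Df) as [c [_ Hc]]; [ | lra].
intros z zxy; now apply continuity_pt_filterlim, cf.
Qed.

Lemma continuous_positive_bounds (f : R -> R) (x y : R) :
  x <= y -> (forall z, x <= z <= y -> continuous f z /\ 0 < f z) ->
  exists m M, 0 < m /\ forall z, x <= z <= y -> m <= f z <= M.
Proof.
intros xy Hf.
assert (cf : forall z, x <= z <= y -> continuity_pt f z).
  intros z zxy; now apply continuity_pt_filterlim, Hf.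
destruct (continuity_ab_min f x y xy cf) as [i [fi ixy]].
destruct (continuity_ab_maj f x y xy cf) as [j [fj jxy]].
exists (f i), (f j); split; [now apply Hf | ].
intros z zxy; split; [now apply fi | now apply fj].
Qed.

(** Composition with this retraction extends a function continuous on [-l, l] to a continuous
    function on the line, as the global lemmas on primitives and angles demand. *)
Definition clamp (l x : R) : R := Rmax (- l) (Rmin l x).

Lemma clamp_id (l x : R) : - l <= x <= l -> clamp l x = x.
Proof. intros xl; unfold clamp; rewrite Rmin_right, Rmax_right; lra. Qed.

Lemma clamp_bound (l x : R) : 0 < l -> - l <= clamp l x <= l.
Proof.
intros l_gt0; unfold clamp.
unfold Rmax, Rmin; repeat destruct Rle_dec; lra.
Qed.

Lemma clamp_lipschitz (l x y : R) : 0 < l ->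
  Rabs (clamp l x - clamp l y) <= Rabs (x - y).
Proof.
intros l_gt0; unfold clamp, Rmax, Rmin, Rabs.
repeat (destruct Rle_dec || destruct Rcase_abs); lra.
Qed.

Lemma continuous_clamp (l : R) (f : R -> R) : 0 < l ->
  continuous_on (fun x => - l <= x <= l) f ->
  forall x, continuous (fun x => f (clamp l x)) x.
Proof.
intros l_gt0 cf x P HP.
destruct (cf (clamp l x) (clamp_bound l x l_gt0) P HP) as [d Hd].
exists d; intros y xy; apply Hd; [ | now apply clamp_bound].
change (Rabs (y - x) < d) in xy.
change (Rabs (clamp l y - clamp l x) < d).
now apply Rle_lt_trans with (2 := xy), clamp_lipschitz.
Qed.

Lemma clamp_id_locally (l x : R) : - l < x < l ->
  locally x (fun y => clamp l y = y).
Proof.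
intros xl; apply (locally_interval _ x (- l) l); [apply xl | apply xl | ].
simpl; intros y ly yl; apply clamp_id; lra.
Qed.

(** Since q decreases, it stays above [kappa] on the whole interval. Then 1 / q is positive at [x1],
    grows at rate at least [p0], and is at most 1 / kappa at [x2]. *)
Lemma riccati_bound (q q' : R -> R) (p0 kappa x1 x2 : R) :
  x1 <= x2 -> 0 <= p0 -> 0 < kappa ->
  (forall x, x1 <= x <= x2 -> is_derive q x (q' x)) ->
  (forall x, x1 <= x <= x2 -> q' x <= - p0 * (q x * q x)) ->
  kappa <= q x2 -> kappa * p0 * (x2 - x1) <= 1.
Proof.
intros x12 p0_ge0 kappa_gt0 Dq q'_le q2.
assert (q_ge : forall x, x1 <= x <= x2 -> kappa <= q x).
  intros x xx; apply Rle_trans with (1 := q2), Ropp_le_cancel.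
  apply (is_derive_incr (fun x => - q x) (fun x => - q' x)); [lra | | ].
    intros z zx; apply (is_derive_opp q), Dq; lra.
  intros z zx; generalize (q'_le z ltac:(lra)) (Rle_0_sqr (q z)); unfold Rsqr; nra.
assert (h : / q x1 - p0 * x1 <= / q x2 - p0 * x2).
  apply (is_derive_incr (fun x => / q x - p0 * x)
    (fun x => - q' x / (q x * q x) - p0)); auto.
    intros x xx; pose proof (Dq x xx) as Dqx; pose proof (q_ge x xx).
    auto_derive; [repeat split; try (eexists; eassumption); lra | ].
    rewrite (is_derive_unique (fun x : R => q x) _ _ Dqx); field; lra.
  intros x xx; pose proof (q_ge x ltac:(lra)) as qx.
  assert (q2_gt0 : 0 < q x * q x) by nra.
  assert (p0 <= - q' x / (q x * q x)); [ | lra].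
  apply Rmult_le_reg_r with (q x * q x); auto.
  unfold Rdiv; rewrite Rmult_assoc, Rinv_l by lra.
  generalize (q'_le x ltac:(lra)); lra.
pose proof (q_ge x1 ltac:(lra)) as q1.
assert (0 < / q x1) by (apply Rinv_0_lt_compat; lra).
assert (/ q x2 <= / kappa) by (apply Rinv_le_contravar; lra).
apply Rmult_le_reg_l with (/ kappa); [apply Rinv_0_lt_compat; lra | ].
rewrite !Rmult_assoc, <- Rmult_assoc, Rinv_l by lra; lra.
Qed.

(** * Reduction of the drift operator to Sturm-Liouville form *)

Section Reduction.

Variables (l xi eps : R) (a : R -> R).
Hypotheses (xi_l : - l < xi < l) (eps_gt0 : 0 < eps).
Hypothesis a_cont : continuous_on (fun x => - l <= x <= l) a.
Hypothesis a_derive : forall x, - l < x < l -> x <> xi -> ex_derive a x.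

Definition drift_primitive (x : R) : R := RInt (fun y => a (clamp l y)) xi x.

Definition drift_weight (x : R) : R := exp (drift_primitive x / eps).

Definition drift_conductance (x : R) : R := / (eps * drift_weight x).

Local Notation W := drift_weight.
Local Notation P := drift_conductance.

Let l_gt0 : 0 < l. Proof. lra. Qed.

Let ac x := a (clamp l x).

Let ac_cont : forall x, continuous ac x.
Proof. exact (continuous_clamp l a l_gt0 a_cont). Qed.

Lemma is_derive_drift_primitive x : is_derive drift_primitive x (a (clamp l x)).
Proof. exact (is_derive_primitive ac xi ac_cont x). Qed.

Lemma drift_primitive_xi : drift_primitive xi = 0.
Proof. exact (RInt_point xi ac). Qed.

Lemma drift_weight_gt0 x : 0 < W x.
Proof. apply exp_pos. Qed.

Lemma drift_conductance_gt0 x : 0 < P x.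
Proof.
apply Rinv_0_lt_compat, Rmult_lt_0_compat; [lra | apply drift_weight_gt0].
Qed.

Lemma is_derive_drift_weight x :
  is_derive W x (a (clamp l x) * W x / eps).
Proof.
pose proof (is_derive_drift_primitive x) as DA; unfold drift_weight.
auto_derive; [ex_derive_context | ].
rewrite (is_derive_unique (fun x : R => drift_primitive x) _ _ DA).
unfold Rdiv; ring.
Qed.

Let W_cont x : continuous W x.
Proof. eapply is_derive_continuous, is_derive_drift_weight. Qed.

Let P_cont x : continuous P x.
Proof.
apply (ex_derive_continuous P); unfold drift_conductance.
auto_derive; split; [eexists; apply is_derive_drift_weight | split; auto].
generalize (drift_weight_gt0 x); nra.
Qed.

Let on_open (f : R -> R) x : - l < x < l ->
  continuous (fun y => f (clamp l y)) x -> continuous f x.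
Proof.
intros xl cf; apply continuous_ext_loc with (2 := cf).
apply filter_imp with (2 := clamp_id_locally l x xl); now intros y ->.
Qed.

(** [phi] and [v] are defined as primitives rather than by their formulas in u, so they are
    differentiable at [xi] and at both ends without further work. They are then identified with eps
    u' - a u and u / W by comparing derivatives away from these points. *)
Lemma eigenvalue_sl_solution lam : eigenvalue l xi eps a lam ->
  sl_eigenvalue P W (- l) l lam.
Proof.
intros [u [cu [ul [ur [[x0 [x0l ux0]] [C1u equ]]]]]].
set (uc x := u (clamp l x)).
assert (cuc : forall x, continuous uc x) by exact (continuous_clamp l u l_gt0 cu).
set (phi0 x := eps * Derive u x - a x * u x).
set (phi x := phi0 xi + lam * RInt uc xi x).
assert (Dphi : forall x, is_derive phi x (lam * uc x)).
  intros x; pose proof (is_derive_primitive uc xi cuc x) as D.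
  set (Iu x := RInt uc xi x) in *; unfold phi; fold Iu.
  auto_derive; [ex_derive_context | ].
  rewrite (is_derive_unique (fun x : R => Iu x) _ _ D); ring.
assert (cphi0 : forall x, - l < x < l -> continuous phi0 x).
  intros x xl; apply (continuous_minus (V := R_NormedModule)).
    apply (continuous_scal_r (V := R_NormedModule) eps (Derive u)), C1u, xl.
  apply (continuous_mult (K := R_AbsRing)).
    apply on_open; auto; apply ac_cont.
  now apply (ex_derive_continuous u), C1u.
assert (phi_eq : forall x, - l < x < l -> phi0 x = phi x).
  intros x xl; apply Rminus_diag_uniq.
  transitivity (phi0 xi - phi xi);
    [ | unfold phi; rewrite RInt_point; unfold zero; simpl; ring].
  apply (derive_zero_const (fun x => phi0 x - phi x)).
    intros z zx.
    assert (zl : - l < z < l /\ z <> xi).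
      revert zx; unfold Rmin, Rmax; destruct Rle_dec; intros; split; lra.
    destruct (equ z (proj1 zl) (proj2 zl)) as [Du' eqz].
    pose proof (proj1 (C1u z (proj1 zl))) as Duz.
    pose proof (a_derive z (proj1 zl) (proj2 zl)) as Daz.
    apply is_derive_ext_value with
      ((eps * Derive_n u 2 z - Derive (fun y => a y * u y) z) - lam * uc z).
      fold (Lop eps a u z); rewrite eqz; unfold uc; rewrite clamp_id by lra; ring.
    apply (is_derive_minus phi0 phi); auto.
    apply (is_derive_minus (fun x => eps * Derive u x) (fun x => a x * u x)).
      apply (is_derive_scal (Derive u)); now apply Derive_correct.
    apply Derive_correct; auto_derive; auto.
  intros z zx.
  assert (zl : - l < z < l).
    revert zx; unfold Rmin, Rmax; destruct Rle_dec; intros; lra.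
  apply (continuous_minus (V := R_NormedModule)); auto.
  eapply is_derive_continuous, Dphi.
set (v x := uc xi / W xi + RInt (fun y => P y * phi y) xi x).
assert (Dv : forall x, is_derive v x (P x * phi x)).
  intros x; rewrite <- (Rplus_0_l (P x * phi x)).
  apply (is_derive_plus (fun _ => uc xi / W xi)).
    apply (is_derive_const (V := R_NormedModule)).
  apply (is_derive_primitive (fun y => P y * phi y)).
  intros y; apply (continuous_mult (K := R_AbsRing)); auto.
  eapply is_derive_continuous, Dphi.
assert (uv : forall x, - l <= x <= l -> uc x = W x * v x).
  intros x xl; pose proof (drift_weight_gt0 x).
  assert (h : uc x / W x - v x = uc xi / W xi - v xi).
    apply (derive_zero_const (fun x => uc x / W x - v x)).
      intros z zx.
      assert (zl : - l < z < l).
        revert zx; unfold Rmin, Rmax; destruct Rle_dec; intros; lra.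
      pose proof (drift_weight_gt0 z) as Wz; pose proof (Dv z) as Dvz.
      pose proof (is_derive_drift_weight z) as DWz.
      assert (Ducz : is_derive uc z (Derive u z)).
        apply is_derive_ext_loc with u; [ | now apply Derive_correct, C1u].
        apply filter_imp with (2 := clamp_id_locally l z zl).
        now unfold uc; intros y ->.
      auto_derive; [repeat split; try (eexists; eassumption); lra | ].
      rewrite (is_derive_unique (fun x : R => uc x) _ _ Ducz).
      rewrite (is_derive_unique (fun x : R => W x) _ _ DWz).
      rewrite (is_derive_unique (fun x : R => v x) _ _ Dvz).
      rewrite <- phi_eq by auto; unfold phi0, uc, drift_conductance.
      rewrite clamp_id by lra; field; lra.
    intros z _; pose proof (drift_weight_gt0 z).
    apply (continuous_minus (V := R_NormedModule)).
      apply (continuous_mult (K := R_AbsRing)); auto.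
      apply (continuous_comp W Rinv); auto.
      apply continuity_pt_filterlim, continuity_pt_inv.
        apply derivable_continuous_pt, derivable_pt_id.
      lra.
    eapply is_derive_continuous, Dv.
  unfold v at 2 in h; rewrite RInt_point in h; unfold zero in h; simpl in h.
  replace (v x) with (uc x / W x) by lra; field; lra.
assert (v0 : forall x, - l <= x <= l -> u x = 0 -> v x = 0).
  intros x xl ux; generalize (uv x xl) (drift_weight_gt0 x).
  unfold uc; rewrite clamp_id, ux by auto; intros h Wx.
  symmetry in h; apply Rmult_integral in h; lra.
exists v, phi; split; [ | split; [ | split]].
      intros x xl; split; auto.
      apply is_derive_ext_value with (2 := Dphi x); rewrite uv by auto; ring.
    apply v0; lra.
  apply v0; lra.
exists x0; split; auto; intros v0x; apply ux0.
generalize (uv x0 ltac:(lra)); unfold uc; rewrite clamp_id, v0x by lra; lra.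
Qed.

Lemma sl_solution_eigenvalue lam : sl_eigenvalue P W (- l) l lam ->
  eigenvalue l xi eps a lam.
Proof.
intros [v [phi [sol [vl [vr [x0 [x0l vx0]]]]]]].
set (u x := W x * v x).
set (u' x := (ac x * u x + phi x) / eps).
assert (Du : forall x, - l <= x <= l -> is_derive u x (u' x)).
  intros x xl; destruct (sol x xl) as [Dv _].
  pose proof (drift_weight_gt0 x) as Wx; pose proof (is_derive_drift_weight x) as DW.
  unfold u; auto_derive; [ex_derive_context | ].
  rewrite (is_derive_unique (fun x : R => v x) _ _ Dv).
  rewrite (is_derive_unique (fun x : R => W x) _ _ DW).
  unfold u', u, drift_conductance, ac; field; lra.
assert (cu : forall x, - l <= x <= l -> continuous u x).
  intros x xl; eapply is_derive_continuous, Du, xl.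
assert (cphi : forall x, - l <= x <= l -> continuous phi x).
  intros x xl; eapply is_derive_continuous, sol, xl.
assert (cu' : forall x, - l < x < l -> continuous u' x).
  intros x xl; apply (continuous_mult (K := R_AbsRing)); [ | apply continuous_const].
  apply (continuous_plus (V := R_NormedModule)); [ | apply cphi; lra].
  apply (continuous_mult (K := R_AbsRing)); [apply ac_cont | apply cu; lra].
assert (Du_loc : forall x, - l < x < l -> locally x (fun y => u' y = Derive u y)).
  intros x xl; apply (locally_interval _ x (- l) l); [apply xl | apply xl | ].
  simpl; intros y ly yl; symmetry; apply is_derive_unique, Du; lra.
exists u; split; [ | split; [ | split; [ | split; [ | split]]]].
          intros x xl; apply filterlim_within_ext with u; auto.
          now apply filterlim_filter_le_1 with (2 := cu x xl), filter_le_within.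
        unfold u; rewrite vl; ring.
      unfold u; rewrite vr; ring.
    exists x0; split; auto; unfold u; generalize (drift_weight_gt0 x0); intros.
    apply Rmult_integral_contrapositive; split; lra.
  intros x xl; split; [exists (u' x); apply Du; lra | ].
  now apply continuous_ext_loc with u'; auto.
intros x xl xxi.
pose proof (a_derive x xl xxi) as [da Da].
assert (Dac : is_derive ac x da).
  apply is_derive_ext_loc with (2 := Da).
  apply filter_imp with (2 := clamp_id_locally l x xl); now unfold ac; intros y ->.
pose proof (Du x ltac:(lra)) as Dux; destruct (sol x ltac:(lra)) as [_ Dphi].
assert (Du' : is_derive u' x ((da * u x + a x * u' x + lam * u x) / eps)).
  unfold u' at 1; auto_derive; [ex_derive_context | ].
  rewrite (is_derive_unique (fun x : R => ac x) _ _ Dac).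
  rewrite (is_derive_unique (fun x : R => u x) _ _ Dux).
  rewrite (is_derive_unique (fun x : R => phi x) _ _ Dphi).
  unfold ac; rewrite clamp_id by lra; unfold u; field; lra.
assert (DDu : is_derive (Derive u) x ((da * u x + a x * u' x + lam * u x) / eps)).
  now apply is_derive_ext_loc with u'; auto.
split; [eexists; apply DDu | unfold Lop].
rewrite (is_derive_unique _ _ _ DDu : Derive_n u 2 x = _).
assert (Dau : is_derive (fun y => a y * u y) x (da * u x + a x * u' x)).
  now apply (is_derive_mult a u); [ | | intros; apply Rmult_comm].
rewrite (is_derive_unique (fun y : R => a y * u y) _ _ Dau); field; lra.
Qed.

(** The clamped coefficients lie between positive constants. These depend on eps, but they serve
    only to obtain the spectrum and do not appear in the result. *)
Lemma drift_spectrum : exists lam : nat -> R,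
  decreasing_enumeration (eigenvalue l xi eps a) lam /\
  forall k, (1 <= k)%nat -> lam k < 0 /\
    exists v phi, sl_solution P W (- l) l (lam k) v phi /\ v (- l) = 0 /\ v l = 0 /\
      (forall x, - l <= x <= l -> v x <> 0 \/ phi x <> 0) /\
      (k = 1%nat -> forall x, - l < x < l -> 0 < v x) /\
      ((2 <= k)%nat -> exists z, - l < z < l /\ v z = 0).
Proof.
destruct (continuous_positive_bounds P (- l) l) as [mP [MP [mP_gt0 HP]]].
    lra.
  intros; split; [apply P_cont | apply drift_conductance_gt0].
destruct (continuous_positive_bounds W (- l) l) as [mW [MW [mW_gt0 HW]]].
    lra.
  intros; split; [apply W_cont | apply drift_weight_gt0].
assert (Pc_cont : forall x, continuous (fun x => P (clamp l x)) x).
  apply continuous_clamp; auto.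
  intros x _; now apply filterlim_filter_le_1 with (2 := P_cont x), filter_le_within.
assert (Wc_cont : forall x, continuous (fun x => W (clamp l x)) x).
  apply continuous_clamp; auto.
  intros x _; now apply filterlim_filter_le_1 with (2 := W_cont x), filter_le_within.
destruct (sturm_liouville_spectrum (fun x => P (clamp l x)) (fun x => W (clamp l x))
  (Rmin mP mW) (Rmax MP MW) (- l) l) as [lam [[decr enum] eigen]]; auto.
        now apply Rmin_glb_lt.
      lra.
    intros x; generalize (HP _ (clamp_bound l x l_gt0)).
    generalize (Rmin_l mP mW) (Rmax_l MP MW); lra.
  intros x; generalize (HW _ (clamp_bound l x l_gt0)).
  generalize (Rmin_r mP mW) (Rmax_r MP MW); lra.
assert (sol_eq : forall mu v phi,
    sl_solution (fun x => P (clamp l x)) (fun x => W (clamp l x)) (- l) l mu v phi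
    <-> sl_solution P W (- l) l mu v phi).
  intros mu v phi; split; intros sol x xl; generalize (sol x xl);
    now rewrite clamp_id.
exists lam; split; [split; auto | ].
  intros mu; rewrite <- enum; split.
    intros eig; destruct (eigenvalue_sl_solution mu eig) as [v [phi [sol H]]].
    exists v, phi; split; auto; now apply sol_eq.
  intros [v [phi [sol H]]]; apply sl_solution_eigenvalue.
  exists v, phi; split; auto; now apply sol_eq.
intros k k1; destruct (eigen k k1) as [neg [v [phi [sol [vl [vr [nz [_ H]]]]]]]].
split; auto; exists v, phi; split; auto; now apply sol_eq.
Qed.

(** * Picone's identity and eigenfunctions with an interior zero *)

Section SecondEigenvalue.

Variables (lam : R) (v phi : R -> R).
Hypothesis sol : sl_solution P W (- l) l lam v phi.
Hypothesis nontrivial : forall x, - l <= x <= l -> v x <> 0 \/ phi x <> 0.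

(* Picone's identity: the derivative of [v phi + r W v^2] is
   [P (phi + r W v)^2 + (lam + r' + (r a - r^2) / eps) W v^2]. *)
Lemma picone_incr (r r' : R -> R) (c x1 x2 : R) :
  - l <= x1 < x2 -> x2 <= l -> 0 < lam + c ->
  (forall x, x1 <= x <= x2 -> is_derive r x (r' x)) ->
  (forall x, x1 < x < x2 -> c <= r' x + (r x * a x - r x * r x) / eps) ->
  v x1 * phi x1 + r x1 * (W x1 * (v x1 * v x1))
  < v x2 * phi x2 + r x2 * (W x2 * (v x2 * v x2)).
Proof.
intros lx1 x2l lamc Dr r'_ge.
apply (is_derive_incr_strict (fun x => v x * phi x + r x * (W x * (v x * v x)))
  (fun x => P x * ((phi x + r x * W x * v x) * (phi x + r x * W x * v x))
    + (lam + (r' x + (r x * a x - r x * r x) / eps)) * (W x * (v x * v x))));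
  [lra | | ].
  intros x x12; destruct (sol x ltac:(lra)) as [Dv Dphi].
  pose proof (Dr x x12) as Drx; pose proof (is_derive_drift_weight x) as DW.
  pose proof (drift_weight_gt0 x).
  auto_derive; [ex_derive_context | ].
  rewrite (is_derive_unique (fun x : R => v x) _ _ Dv).
  rewrite (is_derive_unique (fun x : R => phi x) _ _ Dphi).
  rewrite (is_derive_unique (fun x : R => r x) _ _ Drx).
  rewrite (is_derive_unique (fun x : R => W x) _ _ DW).
  rewrite clamp_id by lra; unfold drift_conductance; field; lra.
intros x x12; specialize (r'_ge x x12).
generalize (drift_weight_gt0 x) (drift_conductance_gt0 x); intros Wx Px.
assert (sq_gt0 : forall y, y <> 0 -> 0 < y * y) by (intros; nra).
destruct (Req_dec (v x) 0) as [v0 | v0].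
  destruct (nontrivial x ltac:(lra)) as [ | phi0]; [lra | ].
  rewrite v0, !Rmult_0_r, Rplus_0_r, Rplus_0_r.
  apply Rmult_lt_0_compat; auto.
apply Rplus_le_lt_0_compat.
  apply Rmult_le_pos; [lra | apply Rle_0_sqr].
apply Rmult_lt_0_compat; [lra | apply Rmult_lt_0_compat; auto].
Qed.

Hypotheses (vl : v (- l) = 0) (vr : v l = 0).

(** The Picone quantity v phi + r W v^2 vanishes at z and at the end of the interval on the same
    side of [xi], yet increases strictly between them if lam > - beta^2 / eps. On the left r equals
    [beta] up to the layer and then rises, staying below 2 beta; the right side is the mirror
    image. *)
Lemma interior_zero_bound (alpha beta c0 z : R) :
  0 < beta -> 2 * beta <= alpha -> 0 < c0 -> 5 * c0 * beta <= 1 ->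
  (forall x, - l < x < xi -> 0 <= a x) ->
  (forall x, xi < x < l -> a x <= 0) ->
  (forall x, - l < x <= xi - c0 * eps -> alpha <= a x) ->
  (forall x, xi + c0 * eps <= x < l -> a x <= - alpha) ->
  - l < xi - c0 * eps -> xi + c0 * eps < l ->
  - l < z < l -> v z = 0 -> lam <= - (beta * beta) / eps.
Proof.
intros beta_gt0 beta_alpha c0_gt0 beta_c0 a_left a_right a_far_left a_far_right
  far_left far_right zl vz.
apply Rnot_lt_le; intros lam_gt.
set (c := beta * beta / eps).
assert (lamc : 0 < lam + c) by (unfold c; unfold Rdiv in *; lra).
assert (c0eps : 0 < c0 * eps) by (apply Rmult_lt_0_compat; lra).
(* The sign s selects the side. Outside the layer r a - r^2 >= beta (2 beta) - beta^2 = beta^2. *)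
assert (outer : forall s x, s = 1 \/ s = -1 -> alpha <= s * a x ->
    c <= 0 + (s * beta * a x - s * beta * (s * beta)) / eps).
  intros s x s1 ax; unfold c; rewrite Rplus_0_l.
  apply Rmult_le_compat_r; [apply Rlt_le, Rinv_0_lt_compat; lra | ].
  destruct s1 as [-> | ->]; nra.
(* In the layer only r a >= 0 is known. The slope contributes beta / c0 >= 5 beta^2, and r^2 <= 4
   beta^2 leaves the required beta^2. *)
assert (inner : forall s r x, s = 1 \/ s = -1 -> 0 <= s * a x ->
    beta <= s * r <= 2 * beta ->
    c <= beta / c0 / eps + (r * a x - r * r) / eps).
  intros s r x s1 ax rb; unfold c.
  replace (beta / c0 / eps + (r * a x - r * r) / eps) with
    ((beta / c0 + (r * a x - r * r)) / eps) by (field; lra).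
  apply Rmult_le_compat_r; [apply Rlt_le, Rinv_0_lt_compat; lra | ].
  assert (5 * beta * beta <= beta / c0).
    apply Rmult_le_reg_r with c0; auto.
    replace (beta / c0 * c0) with beta by (field; lra); nra.
  destruct s1 as [-> | ->]; nra.
assert (Dconst : forall k x, is_derive (fun _ : R => k) x 0).
  intros k x; apply (is_derive_const (V := R_NormedModule)).
destruct (Rle_lt_dec z xi) as [zxi | xiz].
  set (b := xi - c0 * eps) in *.
  assert (b_xi : b < xi) by (unfold b; lra).
  set (r x := beta + beta / c0 / eps * (x - b)).
  assert (Dr : forall x, is_derive r x (beta / c0 / eps)).
    intros x; unfold r; auto_derive; auto; ring.
  assert (rb : r b = 1 * beta) by (unfold r; ring).
  assert (left_incr : forall y, - l < y <= b -> 0 <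
      v y * phi y + 1 * beta * (W y * (v y * v y))).
    intros y yb.
    generalize (picone_incr (fun _ => 1 * beta) (fun _ => 0) c (- l) y
      ltac:(lra) ltac:(lra) lamc (fun x _ => Dconst _ x)).
    rewrite vl, !Rmult_0_r, Rmult_0_l, Rplus_0_l; intros h; apply h.
    intros x xb; apply outer; auto; rewrite Rmult_1_l; apply a_far_left; lra.
  destruct (Rle_lt_dec z b) as [zb | bz].
    generalize (left_incr z ltac:(lra)); rewrite vz; lra.
  assert (h := left_incr b ltac:(lra)); rewrite <- rb in h.
  assert (h' := picone_incr r (fun _ => beta / c0 / eps) c b z ltac:(lra)
    ltac:(lra) lamc (fun x _ => Dr x)).
  rewrite vz, !Rmult_0_r, Rmult_0_l, Rplus_0_l in h'.
  apply (Rlt_asym _ _ h), h'; intros x xb.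
  apply (inner 1); auto; rewrite Rmult_1_l; [apply a_left; lra | ].
  assert (slope : beta / c0 / eps * (x - b) = beta * ((x - b) / (c0 * eps)))
    by (field; lra).
  assert (0 <= (x - b) / (c0 * eps) <= 1).
    split; [apply Rdiv_le_0_compat; lra | ].
    apply Rmult_le_reg_r with (c0 * eps); auto; unfold Rdiv.
    rewrite Rmult_assoc, Rinv_l by lra; unfold b in *; lra.
  unfold r; rewrite slope; nra.
set (b := xi + c0 * eps) in *.
assert (xi_b : xi < b) by (unfold b; lra).
set (r x := - beta + beta / c0 / eps * (x - b)).
assert (Dr : forall x, is_derive r x (beta / c0 / eps)).
  intros x; unfold r; auto_derive; auto; ring.
assert (rb : r b = -1 * beta) by (unfold r; ring).
assert (right_incr : forall y, b <= y < l ->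
    v y * phi y + -1 * beta * (W y * (v y * v y)) < 0).
  intros y yb.
  generalize (picone_incr (fun _ => -1 * beta) (fun _ => 0) c y l
    ltac:(lra) ltac:(lra) lamc (fun x _ => Dconst _ x)).
  rewrite vr, !Rmult_0_r, Rmult_0_l, Rplus_0_l; intros h; apply h.
  intros x xb; apply outer; auto.
  generalize (a_far_right x ltac:(lra)); lra.
destruct (Rle_lt_dec b z) as [bz | zb].
  generalize (right_incr z ltac:(lra)); rewrite vz; lra.
assert (h := right_incr b ltac:(lra)); rewrite <- rb in h.
assert (h' := picone_incr r (fun _ => beta / c0 / eps) c z b ltac:(lra)
  ltac:(lra) lamc (fun x _ => Dr x)).
rewrite vz, !Rmult_0_r, Rmult_0_l, Rplus_0_l in h'.
apply (Rlt_asym _ _ h), h'; intros x xb.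
apply (inner (-1)); auto; [generalize (a_right x ltac:(lra)); lra | ].
assert (slope : beta / c0 / eps * (x - b) = - (beta * ((b - x) / (c0 * eps))))
  by (field; lra).
assert (0 <= (b - x) / (c0 * eps) <= 1).
  split; [apply Rdiv_le_0_compat; lra | ].
  apply Rmult_le_reg_r with (c0 * eps); auto; unfold Rdiv.
  rewrite Rmult_assoc, Rinv_l by lra; unfold b in *; lra.
unfold r; rewrite slope; nra.
Qed.

End SecondEigenvalue.

(** * Size of the weight and exponential smallness of the first eigenvalue *)

Lemma drift_primitive_ge (K x : R) :
  (forall y, - l < y < l -> Rabs (a y) <= K) -> - l <= x <= l ->
  - K * Rabs (x - xi) <= drift_primitive x.
Proof.
intros aK xl; rewrite <- (Rminus_0_r (drift_primitive x)).
rewrite <- drift_primitive_xi.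
assert (Da : forall s y, is_derive (fun x => drift_primitive x + s * x) y
    (a (clamp l y) + s * 1)).
  intros s y; apply (is_derive_plus drift_primitive (fun x => s * x)).
    apply is_derive_drift_primitive.
  auto_derive; auto; ring.
destruct (Rle_lt_dec x xi) as [xxi | xix].
  rewrite Rabs_minus_sym, Rabs_pos_eq by lra.
  assert (- (drift_primitive x + - K * x) <= - (drift_primitive xi + - K * xi)).
    apply (is_derive_incr (fun x => - (drift_primitive x + - K * x))
      (fun x => - (a (clamp l x) + - K * 1))); auto.
      intros y _; now apply (is_derive_opp (fun x => drift_primitive x + - K * x)).
    intros y yx; rewrite clamp_id by lra.
    generalize (proj1 (Rabs_le_between _ _) (aK y ltac:(lra))); lra.
  lra.
rewrite Rabs_pos_eq by lra.
assert (drift_primitive xi + K * xi <= drift_primitive x + K * x); [ | lra].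
apply (is_derive_incr (fun x => drift_primitive x + K * x)
  (fun x => a (clamp l x) + K * 1)); auto; [lra | ].
intros y yx; rewrite clamp_id by lra.
generalize (proj1 (Rabs_le_between _ _) (aK y ltac:(lra))); lra.
Qed.

Lemma drift_primitive_le_left (alpha y x : R) :
  (forall x, - l < x < xi -> 0 <= a x) ->
  (forall x, - l < x <= y -> alpha <= a x) ->
  - l <= x <= y -> y <= xi -> drift_primitive x <= - alpha * (y - x).
Proof.
intros a_left a_far xy yxi.
assert (drift_primitive x - alpha * x <= drift_primitive y - alpha * y).
  apply (is_derive_incr (fun x => drift_primitive x - alpha * x)
    (fun x => a (clamp l x) - alpha * 1)); [lra | | ].
    intros z _; apply (is_derive_minus drift_primitive).
      apply is_derive_drift_primitive.
    auto_derive; auto; ring.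
  intros z zx; rewrite clamp_id by lra; generalize (a_far z ltac:(lra)); lra.
assert (drift_primitive y <= drift_primitive xi).
  apply (is_derive_incr drift_primitive (fun x => a (clamp l x))); auto.
    intros z _; apply is_derive_drift_primitive.
  intros z zy; rewrite clamp_id by lra; apply a_left; lra.
rewrite drift_primitive_xi in *; lra.
Qed.

Lemma drift_primitive_le_right (alpha y x : R) :
  (forall x, xi < x < l -> a x <= 0) ->
  (forall x, y <= x < l -> a x <= - alpha) ->
  xi <= y <= x -> x <= l -> drift_primitive x <= - alpha * (x - y).
Proof.
intros a_right a_far xy yxi.
assert (- (drift_primitive y + alpha * y) <= - (drift_primitive x + alpha * x)).
  apply (is_derive_incr (fun x => - (drift_primitive x + alpha * x))
    (fun x => - (a (clamp l x) + alpha * 1))); [lra | | ].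
    intros z _; apply (is_derive_opp (fun x => drift_primitive x + alpha * x)).
    apply (is_derive_plus drift_primitive).
      apply is_derive_drift_primitive.
    auto_derive; auto; ring.
  intros z zx; rewrite clamp_id by lra; generalize (a_far z ltac:(lra)); lra.
assert (- drift_primitive xi <= - drift_primitive y).
  apply (is_derive_incr (fun x => - drift_primitive x)
    (fun x => - a (clamp l x))); [lra | | ].
    intros z _; apply (is_derive_opp drift_primitive), is_derive_drift_primitive.
  intros z zy; rewrite clamp_id by lra; generalize (a_right z ltac:(lra)); lra.
rewrite drift_primitive_xi in *; lra.
Qed.

(* The logarithmic flux [q = phi / v] satisfies [q' = lam W - P q^2].  Across the
   peak of W it drops by at least [2 kappa], so [|q| >= kappa] on one side of the
   peak, and there the Riccati equation forces [kappa] times the integral of P to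
   be at most 1. *)
Lemma positive_eigenfunction_bound (lam K alpha d : R) (v phi : R -> R) :
  sl_solution P W (- l) l lam v phi -> lam < 0 ->
  (forall x, - l < x < l -> 0 < v x) ->
  (forall x, - l < x < l -> Rabs (a x) <= K) ->
  (forall x, - l < x < xi -> 0 <= a x) ->
  (forall x, xi < x < l -> a x <= 0) ->
  0 < alpha -> 0 < d -> 4 * d <= xi + l -> 4 * d <= l - xi -> eps <= d ->
  (forall x, - l < x <= xi - d -> alpha <= a x) ->
  (forall x, xi + d <= x < l -> a x <= - alpha) ->
  - lam <= exp K / d * exp (- (alpha * d) / eps).
Proof.
intros sol lam_lt0 v_gt0 aK a_left a_right alpha_gt0 d_gt0 d_left d_right eps_d
  a_far_left a_far_right.
set (q x := phi x / v x).
set (q' x := lam * W x - P x * (q x * q x)).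
assert (Dq : forall x, - l < x < l -> is_derive q x (q' x)).
  intros x xl; destruct (sol x ltac:(lra)) as [Dv Dphi].
  pose proof (v_gt0 x xl); unfold q' , q.
  auto_derive; [repeat split; try (eexists; eassumption); lra | ].
  rewrite (is_derive_unique (fun x : R => v x) _ _ Dv).
  rewrite (is_derive_unique (fun x : R => phi x) _ _ Dphi); field; lra.
(* Half of the guaranteed drop of q over [xi - eps, xi + eps], an interval of length 2 eps on which
   W >= exp (- K). *)
set (kappa := - lam * exp (- K) * eps).
assert (kappa_gt0 : 0 < kappa).
  unfold kappa; repeat apply Rmult_lt_0_compat; try lra; apply exp_pos.
assert (Wx : forall x, 0 < W x) by apply drift_weight_gt0.
assert (Px : forall x, 0 < P x) by apply drift_conductance_gt0.
assert (drop : 2 * kappa <= q (xi - eps) - q (xi + eps)).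
  assert (lam * exp (- K) * (xi - eps) - q (xi - eps)
          <= lam * exp (- K) * (xi + eps) - q (xi + eps)); [ | unfold kappa; lra].
  apply (is_derive_incr (fun x => lam * exp (- K) * x - q x)
    (fun x => lam * exp (- K) - q' x)); [lra | | ].
    intros x xx; apply (is_derive_minus (fun x => lam * exp (- K) * x)).
      auto_derive; auto; ring.
    apply Dq; lra.
  intros x xx.
  assert (exp (- K) <= W x).
    apply exp_nondecreasing, Rmult_le_reg_r with eps; auto; unfold Rdiv.
    rewrite Rmult_assoc, Rinv_l, Rmult_1_r by lra.
    apply Rle_trans with (2 := drift_primitive_ge K x aK ltac:(lra)).
    assert (Rabs (x - xi) <= eps) by (apply Rabs_le; lra).
    generalize (aK xi xi_l) (Rabs_pos (a xi)); nra.
  assert (0 <= P x * (q x * q x)).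
    apply Rmult_le_pos, Rle_0_sqr; now apply Rlt_le.
  unfold q'; nra.
set (p0 := exp (alpha * d / eps) / eps).
assert (p0_gt0 : 0 < p0) by (apply Rdiv_lt_0_compat; auto; apply exp_pos).
assert (P_ge : forall x, drift_primitive x <= - alpha * d -> p0 <= P x).
  intros x Ax; unfold p0, drift_conductance, drift_weight.
  rewrite Rinv_mult, <- exp_Ropp.
  apply Rle_trans with (/ eps * exp (alpha * d / eps)); [right; field; lra | ].
  apply Rmult_le_compat_l; [apply Rlt_le, Rinv_0_lt_compat; lra | ].
  apply exp_nondecreasing; unfold Rdiv; rewrite <- Ropp_mult_distr_l_reverse.
  apply Rmult_le_compat_r; [apply Rlt_le, Rinv_0_lt_compat; lra | lra].
assert (q'_le : forall x, p0 <= P x -> q' x <= - p0 * (q x * q x)).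
  intros x px; unfold q'; generalize (Wx x) (Rle_0_sqr (q x)); unfold Rsqr; nra.
assert (main : kappa * p0 * d <= 1).
  assert (mono : forall x y, - l < x <= y -> y < l -> q y <= q x).
    intros x y xy yl; apply Ropp_le_cancel.
    apply (is_derive_incr (fun x => - q x) (fun x => - q' x)); [lra | | ].
      intros z zx; apply (is_derive_opp q), Dq; lra.
    intros z _; generalize (Wx z) (Px z) (Rle_0_sqr (q z)); unfold q', Rsqr; nra.
  destruct (Rle_lt_dec kappa (q (xi - eps))) as [q_left | q_left].
    (* The interval [-l + d, -l + 2 d] avoids -l, where q need not be defined. By 4 d <= xi + l it
       lies at distance at least d to the left of xi - d, so the drift primitive is at most - alpha
       d there. *)
    replace d with ((- l + 2 * d) - (- l + d)) by ring.
    apply (riccati_bound q q'); auto; try lra.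
        intros x xx; apply Dq; lra.
      intros x xx; apply q'_le, P_ge.
      apply Rle_trans with (1 := drift_primitive_le_left alpha (xi - d) x a_left
        a_far_left ltac:(lra) ltac:(lra)); nra.
    apply Rle_trans with (1 := q_left), mono; lra.
  replace d with (- (l - 2 * d) - - (l - d)) by ring.
  (* The reflection q(x) -> - q(-x) preserves the Riccati inequality and turns the case q(xi + eps)
     <= - kappa into the previous one. *)
  apply (riccati_bound (fun x => - q (- x)) (fun x => q' (- x))); auto; try lra.
      intros x xx; apply is_derive_ext_value with (- (-1 * q' (- x))); [ring | ].
      apply (is_derive_opp (fun x => q (- x))), (is_derive_comp q Ropp).
        apply Dq; lra.
      auto_derive; auto; ring.
    intros x xx; rewrite Rmult_opp_opp; apply q'_le, P_ge.
    apply Rle_trans with (1 := drift_primitive_le_right alpha (xi + d) (- x) a_right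
      a_far_right ltac:(lra) ltac:(lra)); nra.
  rewrite Ropp_involutive; generalize (mono (xi + eps) (l - 2 * d)); lra.
replace (- lam) with ((kappa * p0 * d) * (exp K / d * exp (- (alpha * d) / eps))).
  rewrite <- (Rmult_1_l (exp K / d * _)) at 2.
  apply Rmult_le_compat_r; auto; apply Rmult_le_pos, Rlt_le, exp_pos.
  apply Rlt_le, Rdiv_lt_0_compat; auto; apply exp_pos.
unfold kappa, p0.
replace (- (alpha * d) / eps) with (- (alpha * d / eps)) by (field; lra).
rewrite !exp_Ropp; field; repeat split; try lra;
  apply Rgt_not_eq, exp_pos.
Qed.

End Reduction.

(** * Uniform estimates *)

Lemma sup_norm_ge (D : R -> Prop) (f : R -> R) (x : R) :
  D x -> Rbar_le (Rabs (f x)) (sup_norm D f).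
Proof.
intros Dx; apply (proj1 (Lub_Rbar_correct (fun y => exists x, D x /\ y = Rabs (f x)))).
now exists x.
Qed.

Lemma hyp_A0_bound (l xi : R) (a : R -> R -> R) : - l < xi < l -> hyp_A0 l xi a ->
  exists K, 0 < K /\ forall eps x, 0 < eps -> - l < x < l -> Rabs (a eps x) <= K.
Proof.
intros xil [C [C_gt0 HC]]; exists C; split; auto; intros eps x eps_gt0 xl.
specialize (HC eps eps_gt0).
pose proof (sup_norm_ge (fun x => - l < x < l) (a eps) x xl) as Hx.
pose proof (sup_norm_ge (fun x => - l < x < l /\ x <> xi) (Derive (a eps))
  ((xi + l) / 2) ltac:(lra)) as Hd.
pose proof (Rabs_pos (Derive (a eps) ((xi + l) / 2))) as pos.
destruct (sup_norm _ (a eps)) as [s1 | | ]; try easy;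
  destruct (sup_norm _ (Derive (a eps))) as [s2 | | ]; try easy;
  revert HC; simpl in *.
- nra.
- destruct Rle_dec; [ | lra]; destruct Rle_lt_or_eq_dec; [easy | lra].
- destruct Rle_dec; [ | lra]; destruct Rle_lt_or_eq_dec; [easy | lra].
Qed.

Theorem corollary4p5
  (l xi am ap : R) (a : R -> R -> R)
  (Hl : 0 < l) (Hxi : - l < xi < l) (Hpm : ap < 0 < am)
  (Hcont : forall eps, 0 < eps -> continuous_on (fun x => - l <= x <= l) (a eps))
  (HA0 : hyp_A0 l xi a)
  (HA1 : hyp_A1 l xi a)
  (HA2 : hyp_A2 l xi am ap a)
  (HA3 : hyp_A3 xi a) :
  exists C, 0 < C /\ exists eps0, 0 < eps0 /\
    forall eps, 0 < eps < eps0 ->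
      exists lam : nat -> R,
        decreasing_enumeration (eigenvalue l xi eps (a eps)) lam /\
        (forall k, (2 <= k)%nat -> lam k <= - C / eps) /\
        - C * exp (- C / eps) <= lam 1%nat < 0.
Proof.
destruct (hyp_A0_bound l xi a Hxi HA0) as [K [K_gt0 aK]].
destruct (HA2 1 Rlt_0_1) as [c0 [c0_gt0 Hc0]].
(* Half the smaller limit value: for eps < alpha, an error of at most eps outside the layer leaves
   |a| >= alpha. *)
set (alpha := Rmin am (- ap) / 2).
assert (alpha_gt0 : 0 < alpha) by (unfold alpha, Rmin; destruct Rle_dec; lra).
assert (alpha_am : 2 * alpha <= am /\ 2 * alpha <= - ap)
  by (unfold alpha, Rmin; destruct Rle_dec; lra).
set (d := Rmin (xi + l) (l - xi) / 4).
assert (d_gt0 : 0 < d) by (unfold d, Rmin; destruct Rle_dec; lra).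
assert (d_le : 4 * d <= xi + l /\ 4 * d <= l - xi)
  by (unfold d, Rmin; destruct Rle_dec; lra).
set (beta := Rmin (alpha / 2) (/ (5 * c0))).
assert (beta_gt0 : 0 < beta).
  apply Rmin_glb_lt; [lra | apply Rinv_0_lt_compat; lra].
assert (beta_alpha : 2 * beta <= alpha)
  by (generalize (Rmin_l (alpha / 2) (/ (5 * c0))); fold beta; lra).
assert (beta_c0 : 5 * c0 * beta <= 1).
  rewrite <- (Rinv_r (5 * c0)) by lra.
  apply Rmult_le_compat_l; [lra | apply Rmin_r].
(* The first entry serves k >= 2. The second keeps at least half of the decay exponent alpha d in
   reserve, to absorb the prefactor exp K / d. *)
set (C := Rmin (beta * beta) (alpha * d / 2)).
assert (ad_gt0 : 0 < alpha * d) by now apply Rmult_lt_0_compat.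
assert (C_gt0 : 0 < C) by (apply Rmin_glb_lt; nra).
assert (C_beta : C <= beta * beta) by apply Rmin_l.
assert (C_ad : 2 * C <= alpha * d)
  by (generalize (Rmin_r (beta * beta) (alpha * d / 2)); fold C; lra).
clearbody alpha d beta C; exists C; split; auto.
(* The threshold is the value of eps at which exp K / d = C alpha d / (2 eps). *)
set (e1 := alpha * d * (d * C) / (2 * exp K)).
assert (e1_gt0 : 0 < e1).
  apply Rdiv_lt_0_compat; [ | generalize (exp_pos K); lra].
  repeat apply Rmult_lt_0_compat; auto.
exists (Rmin (Rmin alpha d) (Rmin (d / c0) e1)).
split; [repeat apply Rmin_glb_lt; auto; now apply Rdiv_lt_0_compat | ].
intros eps [eps_gt0 eps_lt].
assert (eps_small : eps < alpha /\ eps < d /\ eps < d / c0 /\ eps < e1).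
  apply Rmin_Rgt in eps_lt; destruct eps_lt as [h1 h2].
  apply Rmin_Rgt in h1; apply Rmin_Rgt in h2; lra.
destruct eps_small as [eps_alpha [eps_d [eps_c0 eps_e1]]].
assert (c0eps : c0 * eps < d).
  apply Rmult_lt_compat_l with (r := c0) in eps_c0; auto.
  replace (c0 * (d / c0)) with d in eps_c0 by (field; lra); lra.
destruct (HA1 eps eps_gt0) as [a_derive [a_left' a_right']].
assert (a_left : forall x, - l < x < xi -> 0 <= a eps x).
  intros x xl; apply Rlt_le, a_left'; auto.
assert (a_right : forall x, xi < x < l -> a eps x <= 0).
  intros x xl; apply Rlt_le, a_right'; auto.
assert (c0eps_gt0 : 0 < c0 * eps) by now apply Rmult_lt_0_compat.
assert (a_far_left : forall x, - l < x <= xi - c0 * eps -> alpha <= a eps x).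
  intros x xl; destruct (Hc0 eps x) as [h _]; try lra.
    rewrite Rabs_left; lra.
  unfold step in h; destruct Rlt_dec as [_ | ]; [ | lra].
  apply Rabs_le_between in h; lra.
assert (a_far_right : forall x, xi + c0 * eps <= x < l -> a eps x <= - alpha).
  intros x xl; destruct (Hc0 eps x) as [h _]; try lra.
    rewrite Rabs_pos_eq; lra.
  unfold step in h; destruct Rlt_dec as [ | _]; [lra | ].
  apply Rabs_le_between in h; lra.
destruct (drift_spectrum l xi eps (a eps) Hxi eps_gt0 (Hcont eps eps_gt0)
  (fun x xl xxi => proj1 (a_derive x xl xxi))) as [lam [enum eigen]].
exists lam; split; auto; split.
  intros k k2; destruct (eigen k ltac:(lia))
    as [_ [v [phi [sol [vl [vr [nz [_ zero]]]]]]]].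
  destruct (zero k2) as [z [zl vz]].
  apply Rle_trans with (- (beta * beta) / eps).
    apply (interior_zero_bound l xi eps (a eps) Hxi eps_gt0 (Hcont eps eps_gt0)
      (lam k) v phi sol nz vl vr alpha beta c0 z); auto; lra.
  apply Rmult_le_compat_r; [apply Rlt_le, Rinv_0_lt_compat; lra | lra].
destruct (eigen 1%nat (le_n 1)) as [neg [v [phi [sol [_ [_ [_ [v_gt0 _]]]]]]]].
split; auto.
assert (bound : - lam 1%nat <= exp K / d * exp (- (alpha * d) / eps)).
  apply (positive_eigenfunction_bound l xi eps (a eps) Hxi eps_gt0
    (Hcont eps eps_gt0) (lam 1%nat) K alpha d v phi); auto; try lra;
    intros; [apply a_far_left | apply a_far_right]; lra.
rewrite <- Ropp_mult_distr_l; apply Ropp_le_cancel; rewrite Ropp_involutive.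
apply Rle_trans with (1 := bound).
(* Splits off the factor exp (- C / eps) of the claim. The rest beats the prefactor because exp
   ((alpha d - C) / eps) >= alpha d / (2 eps). *)
replace (- (alpha * d) / eps) with (- (alpha * d - C) / eps + - C / eps)
  by (field; lra).
rewrite exp_plus, <- Rmult_assoc.
apply Rmult_le_compat_r; [apply Rlt_le, exp_pos | ].
set (y := alpha * d / (2 * eps)).
assert (big : y <= exp ((alpha * d - C) / eps)).
  apply Rle_trans with (exp y).
    generalize (exp_ineq1_le y); lra.
  apply exp_nondecreasing; unfold y.
  apply Rmult_le_reg_r with (2 * eps); [lra | ].
  replace (alpha * d / (2 * eps) * (2 * eps)) with (alpha * d) by (field; lra).
  replace ((alpha * d - C) / eps * (2 * eps)) with (2 * (alpha * d - C))
    by (field; lra); lra.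
assert (e1_eps : exp K / d <= C * y).
  unfold y; apply Rmult_le_reg_r with (d * (2 * eps));
    [apply Rmult_lt_0_compat; lra | ].
  replace (exp K / d * (d * (2 * eps))) with (eps * (2 * exp K)) by (field; lra).
  replace (C * (alpha * d / (2 * eps)) * (d * (2 * eps)))
    with (e1 * (2 * exp K)).
    apply Rmult_le_compat_r; generalize (exp_pos K); lra.
  unfold e1; field; split; [lra | apply Rgt_not_eq, exp_pos].
replace (- (alpha * d - C) / eps) with (- ((alpha * d - C) / eps)) by (field; lra).
rewrite exp_Ropp.
apply Rmult_le_reg_r with (exp ((alpha * d - C) / eps)); [apply exp_pos | ].
rewrite Rmult_assoc, Rinv_l, Rmult_1_r by apply Rgt_not_eq, exp_pos.
apply Rle_trans with (1 := e1_eps); apply Rmult_le_compat_l; lra.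
Qed.
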